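(* Let $S$ be a simple non-abelian group, $p$ a prime with $p\mid|S|$, $G$ the maximal perfect central extension of $S$, and $Q$ a Sylow $p$-subgroup of $G$. Assume the following: (i) there exist a group $\widetilde G$ with $G\lhd\widetilde G$ and a finite group $D$ such that the semidirect product $\widetilde G\rtimes D$ is defined, $\widetilde G/G$ is abelian, $\mathrm C_{\widetilde G\rtimes D}(G)=\mathrm Z(\widetilde G)$, $G\lhd\widetilde G\rtimes D$, and $\widetilde G\rtimes D$ induces on $G$ all automorphisms of $G$; (ii) there exists a $(\widetilde G\rtimes D)_Q$-stable subgroup $N<G$ with $\mathrm N_G(Q)\le N$ and $N\neq G$; (iii) maximal extensibility holds for $G\lhd\widetilde G$ and for $N\lhd\widetilde N:=\mathrm N_{\widetilde G}(N)$; (iv) there exists a $(\widetilde G\rtimes D)_Q$-equivariant bijection $\widetilde\Omega:\mathcal G\to\mathcal N$, where $$\mathcal G=\{\chi\in\mathrm{Irr}(\widetilde G)\mid \mathrm{Irr}(G\mid\chi)\subset\mathrm{Irr}_{p'}(G)\},\qquad \mathcal N=\{\psi\in\mathrm{Irr}(\widetilde N)\mid\mathrm{Irr}(N\mid\psi)\subset\mathrm{Irr}_{p'}(N)\},$$ such that $\widetilde\Omega(\mathcal G\cap\mathrm{Irr}(\widetilde G\mid\nu))=\mathcal N\cap\mathrm{Irr}(\widetilde N\mid\nu)$ for every $\nu\in\mathrm{Irr}(\mathrm Z(\widetilde G))$, and $\widetilde\Omega(\chi\lambda)=\widetilde\Omega(\chi)\,\lambda|_{\widetilde N}$ for every $\chi\in\mathcal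 G$ and every $\lambda\in\mathrm{Irr}(\widetilde G/G)$; (v) for every $\chi\in\mathcal G$ there exists some $\chi_0\in\mathrm{Irr}_{p'}(G\mid\chi)$ such that $(\widetilde G\rtimes D)_{\chi_0}=\widetilde G_{\chi_0}\rtimes D_{\chi_0}$ and $\chi_0$ extends to $(G\rtimes D)_{\chi_0}$; (vi) for every $\psi\in\mathcal N$ there exists some $\psi_0\in\mathrm{Irr}(N\mid\psi)$ such that the group $O:=(\widetilde G\rtimes D)_{N,\psi_0}\,G$ satisfies $O=(\widetilde G\cap O)\rtimes(D\cap O)$ and $\psi_0$ extends to $(G\rtimes D)_{N,\psi_0}$. Then the inductive McKay condition holds for $S$ and $p$.
   Context: All groups are finite and characters are complex. $\mathrm{Irr}(X)$ is the set of irreducible characters of $X$, and $\mathrm{Irr}_{p'}(X)$ the subset of those of degree prime to $p$. For $Z\lhd X$ and $\nu\in\mathrm{Irr}(Z)$, $\mathrm{Irr}(X\mid\nu)$ is the set of irreducible constituents of the induced character $\nu^X$; for $\chi\in\mathrm{Irr}(X)$, $\mathrm{Irr}(Z\mid\chi)$ is the set of irreducible constituents of the restriction $\chi|_Z$; $\mathrm{Irr}_{p'}(\,\cdot\mid\cdot\,)$ denotes the subset of those of degree prime to $p$. If a group $O$ acts on $X$, then $O_U$ is the stabilizer of a subgroup $U\le X$, $O_\chi$ the stabilizer of a character $\chi$, $O_{U,\chi}$ the stabilizer of the pair (where $\chi$ is a character of $X$ or of $U$), and $\mathrm{Irr}_O(X)$ is the set of $O$-invariant irreducible characters of $X$. Characters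 of $\widetilde G/G$ are regarded as characters of $\widetilde G$ by inflation. Maximal extensibility holds for $X_1\lhd X_2$ if every $\chi\in\mathrm{Irr}(X_1)$ extends to an irreducible character of its inertia group in $X_2$. Cohomology class: if $X\lhd Y$ and $\theta\in\mathrm{Irr}(X)$ is $Y$-invariant, there is a projective representation $\mathcal P$ of $Y$ whose restriction to $X$ is a linear representation affording $\theta$ and whose factor set $\alpha$ (defined by $\mathcal P(x)\mathcal P(y)=\alpha(x,y)\mathcal P(xy)$) is constant on $X$-cosets; the class in the Schur multiplier $H^2(Y/X,\mathbb C^\times)$ defined by $\alpha$ depends only on $\theta$ and is denoted $[\theta]$. Dot notation: if $X\lhd A$, $C=\mathrm C_A(X)$, $N$ is a subgroup with $\mathrm Z(X)\le N\le X$, $\theta\in\mathrm{Irr}(N)$, and $\epsilon\in\mathrm{Irr}(C)$ is linear with $\mathrm{Irr}(\mathrm Z(X)\mid\theta)=\mathrm{Irr}(\mathrm Z(X)\mid\epsilon)$, then $\theta\cdot\epsilon$ is the unique extension of $\theta$ to $NC$ whose restriction to $C$ has $\epsilon$ as its only irreducible constituent. Condition (cohom). Let $S$ be a non-abelian simple group, $p$ a prime dividing $|S|$, $G$ the maximal perfect central extension (universal covering group) of $S$, $Q$ a Sylow $p$-subgroup of $G$, and $N$ an $\mathrm{Aut}(G)_Q$-stable subgroup of $G$ with $\mathrm N_G(Q)\le N\ne G$. A pair $(\chi,\psi)$ with $\chi\in\mathrm{Irr}_{p'}(G)$, $\psi\in\mathrm{Irr}_{p'}(N)$ satisfies (cohom)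 if: (i) $\mathrm{Irr}(\mathrm Z(G)\mid\chi)=\mathrm{Irr}(\mathrm Z(G)\mid\psi)$; (ii) $\mathrm{Aut}(G)_{N,\chi}=\mathrm{Aut}(G)_{N,\psi}$; (iii) for $\overline G=G/\ker(\chi|_{\mathrm Z(G)})$ and $\overline N=N/\ker(\chi|_{\mathrm Z(G)})$ (with $\chi,\psi$ regarded as characters of $\overline G,\overline N$) there exists a group $A$ with $\overline G\lhd A$, $A_\chi=A$, $C=\mathrm C_A(\overline G)$ abelian and $A/(\overline GC)=\mathrm{Out}(\overline G)_\chi$ (via the action on $\overline G$), and for some $\epsilon\in\mathrm{Irr}_A(C)$ with $\mathrm{Irr}(\mathrm Z(\overline G)\mid\epsilon)=\mathrm{Irr}(\mathrm Z(\overline G)\mid\chi)$ the classes $[\chi\cdot\epsilon]$ and $[\psi\cdot\epsilon]$ in the Schur multipliers of $A/\overline GC$ and $\mathrm N_A(\overline N)/\overline NC$, respectively, coincide under the natural isomorphism $A/\overline GC\cong\mathrm N_A(\overline N)/\overline NC$. Inductive McKay condition. With $S$, $p$, $G$, $Q$ as just described, $S$ satisfies the inductive McKay condition for $p$ if: (1) there is an $\mathrm{Aut}(G)_Q$-stable subgroup $N$ of $G$ with $\mathrm N_G(Q)\le N\ne G$; (2) there is an $\mathrm{Aut}(G)_Q$-equivariant bijection $\Omega:\mathrm{Irr}_{p'}(G)\to\mathrm{Irr}_{p'}(N)$ with $\Omega(\mathrm{Irr}_{p'}(G\mid\nu))=\mathrm{Irr}_{p'}(N\mid\nu)$ for every $\nu\in\mathrm{Irr}(\mathrm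 Z(G))$; (3) (cohom) holds for $(\chi,\Omega(\chi))$ for every $\chi\in\mathrm{Irr}_{p'}(G)$. *)

(* Defs.v *)
From HB Require Import structures.
From mathcomp Require Import all_boot all_order all_algebra.
From mathcomp Require Import all_fingroup all_solvable all_field all_character.

Set Implicit Arguments.
Unset Strict Implicit.
Unset Printing Implicit Defensive.

Import Order.TTheory GRing.Theory Num.Theory.
Local Open Scope group_scope.
Local Open Scope ring_scope.

(* Irreducible characters of X are represented by their indices i : Iirr X;   *)
(* complex characters take their values in algC.                              *)

Definition perfect_central_extension (sT gT : finGroupType) (S : {group sT})
    (G : {group gT}) (pi : {morphism G >-> sT}) : Prop :=
  [/\ [~: G, G]%g = G, (pi @* G)%g = S & ('ker pi \subset 'Z(G))%g].

(* G is maximal: every perfect central extension of S is a quotient of G,     *)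
(* compatibly with the projections to S.                                      *)
Definition maximal_perfect_central_extension (sT gT : finGroupType)
    (S : {group sT}) (G : {group gT}) (pi : {morphism G >-> sT}) : Prop :=
  perfect_central_extension S pi /\
  forall (hT : finGroupType) (H : {group hT}) (rho : {morphism H >-> sT}),
    perfect_central_extension S rho ->
    exists f : {morphism G >-> hT},
      (f @* G)%g = H /\ {in G, forall x, rho (f x) = pi x}.

Definition Irr_p' (gT : finGroupType) (p : nat) (X : {set gT})
    : {set Iirr X} :=
  [set i : Iirr X | ~~ (p %| 'chi_i 1%g)%C].

(* Irr(X | nu) for nu in Irr(Z), Z <= X. *)
Definition Irr_above (gT : finGroupType) (Z X : {set gT}) (nu : Iirr Z)
    : {set Iirr X} :=
  [set i | i \in irr_constt ('Ind[X] 'chi_nu)].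

(* Irr(Z | phi) for a character phi of X, Z <= X. *)
Definition Irr_below (gT : finGroupType) (Z X : {set gT}) (phi : 'CF(X))
    : {set Iirr Z} :=
  [set i | i \in irr_constt ('Res[Z] phi)].

(* {chi in Irr(Y) | Irr(X | chi) is contained in Irr_p'(X)} *)
Definition Irr_over_p' (gT : finGroupType) (p : nat) (X Y : {set gT})
    : {set Iirr Y} :=
  [set i : Iirr Y | Irr_below X 'chi_i \subset Irr_p' p X].

Definition extends_to (gT : finGroupType) (X Y : {set gT}) (phi : 'CF(X))
    : Prop :=
  exists i : Iirr Y, 'Res[X] 'chi_i = phi.

Definition maximal_extensibility (gT : finGroupType) (X Y : {set gT}) : Prop :=
  forall i : Iirr X, extends_to 'I_Y['chi_i] 'chi_i.

(* phi' = phi ^ a, where phi and phi' are characters of a subgroup X that is  *)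
(* stable under a; phi' is determined by phi and a.                           *)
Definition cf_aut_image (gT : finGroupType) (X : {set gT}) (a : {perm gT})
    (phi phi' : 'CF(X)) : Prop :=
  {in X, forall x, phi' (a x) = phi x}.

(* Aut(G)_U *)
Definition Aut_stab (gT : finGroupType) (G U : {set gT}) : {set {perm gT}} :=
  'N_(Aut G)(U | 'P)%g.

(* Aut(G)_{U, phi} for U <= G and phi a character of X = U or X = G. *)
Definition Aut_stab_char (gT : finGroupType) (G U X : {set gT})
    (phi : 'CF(X)) : {set {perm gT}} :=
  [set a in Aut_stab G U | [forall x in X, phi (a x) == phi x]].

Definition Inn (gT : finGroupType) (G : {group gT}) : {group {perm gT}} :=
  (conj_aut G @* G)%G.

(* Out(G)_phi *)
Definition Out_stab_char (gT : finGroupType) (G : {group gT}) (phi : 'CF(G))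
    : {set coset_of (Inn G)} :=
  (Aut_stab_char G G phi / Inn G)%g.

(* P is a projective representation of Y restricting to a linear              *)
(* representation of X affording theta, with factor set alpha.  Constancy of  *)
(* the factor set on X-cosets is built into the type of alpha.                *)
Definition proj_repr_over (gT : finGroupType) (X Y : {group gT})
    (theta : 'CF(X)) (n : nat) (P : gT -> 'M[algC]_n)
    (alpha : coset_of X -> coset_of X -> algC) : Prop :=
  [/\ {in Y, forall y, P y \in unitmx},
      exists2 rX : mx_representation algC X n,
        {in X, P =1 rX} & cfRepr rX = theta
    & {in Y &, forall x y,
        P x *m P y = alpha (coset X x) (coset X y) *: P (x * y)%g}].

Definition cohomologous (hT : finGroupType) (H : {set hT})
    (alpha beta : hT -> hT -> algC) : Prop :=
  exists2 mu : hT -> algC, {in H, forall x, mu x != 0} &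
    {in H &, forall x y,
      beta x y = alpha x y * (mu x * mu y / mu (x * y)%g)}.

(* beta lies in the class [theta] in the Schur multiplier of Y / X. *)
Definition in_cohom_class (gT : finGroupType) (X Y : {group gT})
    (theta : 'CF(X)) (beta : coset_of X -> coset_of X -> algC) : Prop :=
  exists n (P : gT -> 'M[algC]_n) alpha,
    proj_repr_over Y theta P alpha /\ cohomologous (Y / X)%g alpha beta.

(* phi = theta . epsilon, where C centralises N, so that N <*> C is N C. *)
Definition is_dot (gT : finGroupType) (N C : {group gT}) (theta : 'CF(N))
    (epsilon : Iirr C) (phi : 'CF(N <*> C)) : Prop :=
  [/\ phi \in irr (N <*> C), 'Res[N] phi = theta
    & Irr_below C phi = [set epsilon]].

(* The existence of the morphisms g and iota expresses that the natural maps  *)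
(* A / GC -> Out(G) and 'N_A(N) / NC -> A / GC are isomorphisms onto          *)
(* Out(G)_chi and A / GC; both morphisms are determined by their values on    *)
(* cosets.  In cohom, G and N stand for the quotients G-bar and N-bar.        *)
Definition cohom_in (gT : finGroupType) (A G N : {group gT})
    (chi : 'CF(G)) (psi : 'CF(N)) : Prop :=
  let C := 'C_A(G)%G in
  let GC := (G <*> C)%G in
  let NC := (N <*> C)%G in
  [/\ G <| A, 'I_A[chi] = A, abelian C,
      exists g : {morphism (A / GC)%g >-> coset_of (Inn G)},
        isom (A / GC) (Out_stab_char chi) g /\
        {in A, forall a, g (coset GC a) = coset (Inn G) (conj_aut G a)}
    & exists epsilon : Iirr C,
      [/\ 'I_A['chi_epsilon] = A,
          Irr_below 'Z(G) 'chi_epsilon = Irr_below 'Z(G) chi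
        & exists (chi_eps : 'CF(G <*> C)) (psi_eps : 'CF(N <*> C))
                 (iota : {morphism ('N_A(N) / NC)%g >-> coset_of GC}),
          [/\ is_dot chi epsilon chi_eps, is_dot psi epsilon psi_eps,
              isom ('N_A(N) / NC) (A / GC) iota,
              {in 'N_A(N), forall a, iota (coset NC a) = coset GC a}
            & exists alpha : coset_of GC -> coset_of GC -> algC,
                @in_cohom_class gT GC A chi_eps alpha /\
                @in_cohom_class gT NC 'N_A(N)%G psi_eps
                  (fun x y => alpha (iota x) (iota y))]]]%g.

(* G-bar = G / K is identified with its image under the embedding f; the      *)
(* characters chi', psi' of f(G / K), f(N / K) are the transports of chi, psi *)
(* seen as characters of G / K and N / K.                                     *)
Definition cohom (gT : finGroupType) (G N : {group gT})
    (chi : 'CF(G)) (psi : 'CF(N)) : Prop :=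
  let K := cfker ('Res['Z(G)%g] chi) in
  [/\ Irr_below 'Z(G) chi = Irr_below 'Z(G) psi,
      Aut_stab_char G N chi = Aut_stab_char G N psi
    & exists (aT : finGroupType) (A : {group aT})
             (f : {morphism (G / K)%g >-> aT})
             (chi' : 'CF(f @* (G / K))) (psi' : 'CF(f @* (N / K))),
      [/\ 'injm f, cfMorph chi' = (chi / K)%CF, cfMorph psi' = (psi / K)%CF
        & @cohom_in aT A (f @* (G / K))%G (f @* (N / K))%G chi' psi']]%g.

(* The inductive McKay condition of the simple group S for p, where G is the  *)
(* maximal perfect central extension of S and Q is a Sylow p-subgroup of G;   *)
(* it depends on S only through G.                                            *)
Definition inductive_McKay (p : nat) (gT : finGroupType) (G Q : {group gT})
    : Prop :=
  exists N : {group gT},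
    [/\ Aut_stab G Q \subset Aut_stab G N, 'N_G(Q) \subset N, N \proper G
      & exists Omega : Iirr G -> Iirr N,
        [/\ {in Irr_p' p G &, injective Omega},
            Omega @: Irr_p' p G = Irr_p' p N,
            {in Aut_stab G Q, forall a, {in Irr_p' p G &, forall i j,
               cf_aut_image a 'chi_i 'chi_j ->
               cf_aut_image a 'chi_(Omega i) 'chi_(Omega j)}},
            forall nu : Iirr 'Z(G),
              Omega @: (Irr_p' p G :&: Irr_above G nu) =
                Irr_p' p N :&: Irr_above N nu
          & {in Irr_p' p G, forall i, cohom 'chi_i 'chi_(Omega i)}]]%g.

(* Main.v *)
Require Import Defs.
From HB Require Import structures.
From mathcomp Require Import all_boot all_order all_algebra.
From mathcomp Require Import all_fingroup all_solvable all_field all_character.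

Set Implicit Arguments.
Unset Strict Implicit.
Unset Printing Implicit Defensive.

Import Order.TTheory GRing.Theory Num.Theory.
Local Open Scope group_scope.
Local Open Scope ring_scope.

(** Write NT for 'N_Gt(N), M for 'N_GD(N) and R for 'N_GD(Q).  By the Frattini
argument GD = G R and M = N R, so that on characters of G, and on characters
of N, the groups GD and M act through R.

The bijection.  As Gt / G is abelian and the characters of G extend to their
inertia groups in Gt, Clifford theory says that the irreducible characters of
Gt above a fixed character of G form one orbit under multiplication by the
linear characters of Gt / G, while those of G below a fixed character of Gt
form one Gt-orbit [clifford_orbit].  The same is true of N in NT, and the
linear characters of NT / N are the restrictions of those of Gt / G.  Since
Omega commutes with these multiplications and with R, it matches the Gt-orbits
on Irr_p'(G) with the NT-orbits on Irr_p'(N), compatibly with R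
[Omega_conj_orbit].  In matched orbits choose chi as in stab_G and psi as in stab_N.
The linear characters fixing a character above chi determine the stabiliser of
chi in Gt, and likewise for psi, whence these stabilisers correspond
[Omega_inertia_Gt]; the stabilisers of the two orbits correspond too, and the
semidirect decompositions in stab_G and stab_N recover the stabiliser of chi from
its Gt-part and from that of its orbit.  So chi and psi have the same
stabiliser in R [good_inertia_GD], the map sending chi ^ r to psi ^ r is well
defined, and choosing one pair in each R-orbit gives the required bijection
[equivariant_bijection].

The cohomology classes.  Let A1 be the stabiliser of chi in GD.  If X1 extends
a representation affording chi to the stabiliser in Gt, and X2 extends it to
the stabiliser in G <*> D, then P(t h) = X1(t) X2(h) is a projective
representation of A1 whose factor set is made of the values of linear
characters la_h such that the character chi1 of X1 satisfies
chi1 ^ h = chi1 * la_h.  The same construction applies to psi.  If chi1 induces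
to a character of Gt and psi1 induces to its image under Omega, the
equivariance and the multiplicativity of Omega give the same la_h on both
sides, hence equal factor sets; and both projective representations send an
element of 'C_GD(G) = 'Z(Gt) to the same scalar, because Omega preserves
central characters [linked_of_extensions, good_linked].

The group A.  A quotient of A1 is not enough here, for nothing provides a linear
character of 'Z(Gt) that is A1-invariant and lies below chi on 'Z(G).  Let A
consist of the pairs (action of y on G, c P(y)), for y in A1 and c a root of
unity.  It contains G-bar as the pairs (action of g, P(g)), and only scalars
centralise G-bar, so epsilon is the scalar character; the second projection is
a linear representation of A extending chi . epsilon.  Because the two factor
sets and the two central scalars agree, sending (action of y, c P(y)) to
c P'(y) is a well-defined linear representation extending psi . epsilon.  So
both classes are trivial [cohom_in_of_reprs, cohom_of_linked].  That A induces
all automorphisms of G-bar fixing chi holds because automorphisms of a central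
quotient of G lift to G, by maximality of G [cover_lift_aut]. *)

(** * Finite matrix groups *)

(** A finite group of matrices over an infinite field is not a finite type; this
trades it for a finite group type with an injection into the matrices. *)
Lemma finite_matrix_group n (s : seq 'M[algC]_n) :
    1%:M \in s -> {in s &, forall a b, a *m b \in s} ->
    {in s, forall a, a \in unitmx /\ invmx a \in s} ->
  exists (hT : finGroupType) (r : hT -> 'M[algC]_n),
    [/\ injective r, r 1%g = 1%:M, {morph r : x y / (x * y)%g >-> x *m y}
      & forall a, a \in s -> exists x, r x = a].
Proof.
move=> s1 sM sV.
pose mul (x y : seq_sub s) := SeqSub (sM _ _ (ssvalP x) (ssvalP y)).
pose inv (x : seq_sub s) := SeqSub (proj2 (sV _ (ssvalP x))).
have mulA : associative mul by move=> x y z; apply: val_inj; apply: mulmxA.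
have mul1 : left_id (SeqSub s1) mul by move=> x; apply: val_inj; apply: mul1mx.
have mulV : left_inverse (SeqSub s1) inv mul.
  by move=> x; apply: val_inj; apply: mulVmx; case: (sV _ (ssvalP x)).
pose hT : finGroupType :=
  HB.pack (seq_sub s) (isMulGroup.Build (seq_sub s) mulA mul1 mulV).
exists hT, (fun x : hT => ssval x); split=> // [|a sa].
  exact: val_inj.
by exists (SeqSub sa).
Qed.

(** * Automorphisms of quotients of a universal covering group *)
Section Lifting.
Local Open Scope group_scope.

Lemma perfect_morph_abelian (gT rT : finGroupType) (G : {group gT})
    (f : {morphism G >-> rT}) :
  [~: G, G] = G -> abelian (f @* G) -> {in G, forall x, f x = 1}.
Proof.
move=> perfG /commG1P abf x Gx; apply/set1gP.
by rewrite -abf -morphimR ?subxx // perfG mem_morphim.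
Qed.

(** The map g |-> [~ g, y] is a morphism from the perfect group G to the abelian
group 'Z(G), hence trivial. *)
Lemma perfect_cent_mod_center (gT : finGroupType) (G : {group gT}) y :
  [~: G, G] = G -> y \in 'N(G) -> {in G, forall g, [~ g, y] \in 'C(G)} ->
  y \in 'C(G).
Proof.
move=> perfG nGy cGy.
have sRZ g: g \in G -> [~ g, y] \in 'Z(G).
  by move=> Gg; rewrite inE cGy // groupM ?groupV // memJ_norm.
have fM : {in G &, {morph (fun g => [~ g, y]) : g h / g * h}}.
  move=> g h Gg Gh /=; rewrite commMgJ; congr (_ * _).
  by rewrite conjgE (centP (cGy g Gg) h Gh) mulKg.
have abf : abelian (Morphism fM @* G).
  apply: abelianS (center_abelian G); apply/subsetP=> _ /morphimP[g _ Gg ->].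
  exact: sRZ.
apply/centP=> g Gg; apply/commgP; rewrite -invg_comm.
by have /= -> := perfect_morph_abelian perfG abf Gg; rewrite invg1.
Qed.

(** E is the product of E^`(1) and a central subgroup, so that commutators of E
are already commutators of elements of E^`(1). *)
Lemma derived_central_ext_perfect (gT rT : finGroupType) (E : {group gT})
    (f : {morphism E >-> rT}) :
  'ker f \subset 'Z(E) -> [~: f @* E, f @* E] = f @* E ->
  [~: E^`(1), E^`(1)] = E^`(1) /\ f @* E^`(1) = f @* E.
Proof.
move=> skZ perf.
have fE' : f @* E^`(1) = f @* E by rewrite morphim_der // derg1 perf.
split=> //; apply/eqP;
  rewrite eqEsubset (subset_trans (commgS _ (der_sub 1 E))) ?commg_subl ?der_norm //=.
have EE' : E = E^`(1) * 'Z(E) :> {set gT}.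
  apply/eqP; rewrite eqEsubset mul_subG ?der_sub ?center_sub // andbT.
  apply/subsetP=> x Ex; have: f x \in f @* E^`(1) by rewrite fE' mem_morphim.
  case/morphimP=> y Ey E'y fxy; rewrite -(mulKVg y x) mem_mulg //.
  by rewrite (subsetP skZ) // !inE groupM ?groupV //= morphM ?groupV // morphV //
    fxy mulVg.
suff: [~: E, E] \subset [~: E^`(1), E^`(1)] by [].
have dec u : u \in E -> exists a z, [/\ a \in E^`(1), z \in 'Z(E) & u = a * z].
  by rewrite {1}EE' => /mulsgP[a z E'a Zz ->]; exists a, z.
rewrite gen_subG; apply/subsetP=> _ /imset2P[x y Ex Ey ->].
have [a [z [E'a /setIP[_ cEz] ->]]] := dec x Ex;
  have [b [w [E'b /setIP[Ew cEw] ->]]] := dec y Ey.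
have Eab c: c \in E^`(1) -> c \in E by apply: subsetP (der_sub 1 E) c.
have cE t u: t \in 'C(E) -> u \in E -> [~ t, u] = 1.
  by move=> /centP cEt Eu; apply/eqP/commgP/cEt.
have cEJ t u: t \in 'C(E) -> u \in E -> u ^ t = u.
  by move=> /centP cEt Eu; rewrite conjgE -(cEt u Eu) mulKg.
have [Ea Eb] := (Eab a E'a, Eab b E'b).
suff ->: [~ a * z, b * w] = [~ a, b] by apply: mem_commg.
rewrite commMgJ (cE z) ?groupM // mulg1 commgMJ -[[~ a, w]]invgK invg_comm (cE w) //.
by rewrite invg1 mul1g (cEJ w) ?(cEJ z) // groupR.
Qed.

Lemma surj_endo_aut (gT : finGroupType) (G : {group gT})
    (f : {morphism G >-> gT}) :
  f @* G = G -> exists2 s, s \in Aut G & {in G, s =1 f}.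
Proof.
move=> fG; have injf : 'injm f.
  by apply/injmP/imset_injP; rewrite -morphimEdom fG.
by exists (aut injf fG); [apply: Aut_aut | apply: autE].
Qed.

(** The pairs (x, y) with t (h x) = h y form a central extension E of S, whose
derived subgroup is a perfect one, hence an image of G.  Both coordinates of
G -> E^`(1) are onto G, hence automorphisms, and the quotient of the second by
the first lifts t. *)
Lemma cover_lift_aut (sT gT aT : finGroupType) (S : {group sT}) (G : {group gT})
    (pi : {morphism G >-> sT}) (h : {morphism G >-> aT}) (t : {perm aT}) :
  maximal_perfect_central_extension S pi -> 'ker h \subset 'Z(G) ->
  t \in Aut (h @* G) ->
  exists2 s, s \in Aut G & {in G, forall x, h (s x) = t (h x)}.
Proof.
move=> [[perfG piG skpi] maxG] skh Aut_t.
have tM : {in h @* G &, {morph t : x y / x * y}}.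
  by move: Aut_t; rewrite inE => /andP[_ /morphicP].
have hG x : x \in G -> h x \in h @* G by move=> Gx; apply: mem_morphim.
pose E0 := [set u : gT * gT | [&& u.1 \in G, u.2 \in G & t (h u.1) == h u.2]].
have gE : group_set E0.
  apply/group_setP; split=> [|u v].
    rewrite inE /= !group1 /= !morph1.
    by rewrite -(autmE Aut_t) morph1.
  rewrite !inE => /and3P[Gu1 Gu2 /eqP tu] /and3P[Gv1 Gv2 /eqP tv] /=.
  by rewrite !groupM //= !morphM // tM ?hG // tu tv.
pose E := Group gE.
have EP u : u \in E -> [/\ u.1 \in G, u.2 \in G & t (h u.1) = h u.2].
  by rewrite inE => /and3P[? ? /eqP].
pose f1 := [morphism of restrm (subsetT E) (@fst gT gT)].
pose f2 := [morphism of restrm (subsetT E) (@snd gT gT)].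
have f1E : f1 @* E = G.
  apply/setP=> x; apply/morphimP/idP=> [[u Eu _ ->] | Gx]; first by case: (EP u Eu).
  have /morphimP[y _ Gy thx] : t (h x) \in h @* G by rewrite Aut_closed ?hG.
  by exists (x, y) => //; rewrite inE /= Gx Gy thx /=.
have f2E : f2 @* E = G.
  apply/setP=> y; apply/morphimP/idP=> [[u Eu _ ->] | Gy]; first by case: (EP u Eu).
  have: h y \in autm Aut_t @* (h @* G) by rewrite im_autm hG.
  case/morphimP=> _ _ /morphimP[x _ Gx ->] /= hy.
  by exists (x, y) => //; rewrite inE /= Gx Gy hy /=.
have rhoM : {in E^`(1) &, {morph (fun u : gT * gT => pi u.1) : u v / u * v}}.
  by move=> u v /(subsetP (der_sub 1 E))/EP[Gu _ _] /(subsetP (der_sub 1 E))/EP[Gv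
    _ _] /=; rewrite morphM.
pose rho := Morphism rhoM.
have f1M : {in E &, {morph (fun u : gT * gT => pi u.1) : u v / u * v}}.
  by move=> u v /EP[Gu _ _] /EP[Gv _ _] /=; rewrite morphM.
pose rho0 := Morphism f1M.
have rho0E : rho0 @* E = S.
  rewrite -piG; apply/setP=> x; apply/morphimP/morphimP.
    by case=> u Eu _ ->; exists u.1 => //; case: (EP u Eu).
  case=> y _ Gy ->; have: y \in f1 @* E by rewrite f1E.
  by case/morphimP=> u Eu _ ->; exists u.
have skE : 'ker rho0 \subset 'Z(E).
  apply/subsetP=> u /morphpreP[Eu /set1P /= pu1]; have [Gu1 Gu2 tu] := EP u Eu.
  have cu1 : u.1 \in 'C(G).
    by apply: (subsetP (subset_trans skpi (subsetIr _ _))); rewrite !inE Gu1 /= pu1.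
  have cu2 : u.2 \in 'C(G).
    apply: perfect_cent_mod_center => // [|g Gg]; first exact: subsetP (normG G) _ Gu2.
    apply: (subsetP (subset_trans skh (subsetIr _ _))).
    have: h g \in autm Aut_t @* (h @* G) by rewrite im_autm hG.
    case/morphimP=> _ _ /morphimP[x _ Gx ->] /= hg.
    rewrite !inE groupR //= morphR // hg -tu.
    rewrite -(autmE Aut_t) -morphR ?hG // -morphR //.
    by rewrite (eqP (introT commgP _)) ?morph1 //; apply/commute_sym/(centP cu1).
  rewrite inE Eu; apply/centP=> v /EP[Gv1 Gv2 _].
  by case: u v cu1 cu2 Gv1 Gv2 {Eu pu1 Gu1 Gu2 tu} =>
    [? ?] [? ?] /= /centP c1 /centP c2 ? ?; congr (_, _); [apply: c1 | apply: c2].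
have perfS : [~: rho0 @* E, rho0 @* E] = rho0 @* E.
  by rewrite rho0E -piG -morphimR ?perfG.
have [perfE' rhoE'] := derived_central_ext_perfect skE perfS.
have : perfect_central_extension S rho.
  split=> //; first by rewrite -rho0E -rhoE' /morphim setIid (setIidPr (der_sub 1 E)).
  apply/subsetP=> u /morphpreP[E'u ru]; rewrite inE E'u.
  have: u \in 'Z(E) by apply: (subsetP skE); apply/morphpreP; split=> //;
    apply: (subsetP (der_sub 1 E)).
  by case/setIP=> _; apply: (subsetP (centS (der_sub 1 E))).
case/maxG=> F [FG _].
have FE x : x \in G -> F x \in E.
  by move=> Gx; rewrite (subsetP (der_sub 1 E)) // -FG mem_morphim.
have aut_of (f : {morphism E >-> gT}) : f @* E = G ->
    exists2 s, s \in Aut G & {in G, forall x, s x = f (F x)}.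
  move=> fE; have fM : {in G &, {morph f \o F : x y / x * y}}.
    by move=> x y Gx Gy /=; rewrite !morphM ?FE.
  apply: (surj_endo_aut (f := Morphism fM)).
  transitivity (f @* (F @* G)); last by rewrite FG morphim_der // fE.
  apply/setP=> y; apply/morphimP/morphimP.
    by case=> x _ Gx ->; exists (F x); rewrite ?FE ?mem_morphim.
  by case=> _ _ /morphimP[x _ Gx ->] ->; exists x.
have [s1 As1 s1E] := aut_of _ f1E; have [s2 As2 s2E] := aut_of _ f2E.
exists (s1^-1 * s2); first by rewrite groupM ?groupV.
move=> x Gx; have Gs1x : s1^-1 x \in G by rewrite Aut_closed ?groupV.
rewrite permM s2E // -[in RHS](permKV s1 x) s1E //.
by case: (EP _ (FE _ Gs1x)).
Qed.
End Lifting.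

(** * The cohomological condition from two linear representations *)
Lemma Irr_belowZ (gT : finGroupType) (Z X : {group gT}) (phi : 'CF(X)) a e :
  a != 0 -> 'Res[Z] phi = a *: 'chi_e -> Irr_below Z phi = [set e].
Proof.
move=> nz_a Dphi; apply/setP=> i; rewrite !inE Dphi cfdotZl cfdot_irr.
by rewrite mulf_eq0 (negPf nz_a) pnatr_eq0 eqb0 negbK eq_sym.
Qed.

(** A linear representation of Y is a projective one with factor set 1. *)
Lemma trivial_cohom_class (gT : finGroupType) (X Y : {group gT}) n
    (R : mx_representation algC Y n) (beta : coset_of X -> coset_of X -> algC) :
  X \subset Y -> (forall x y, beta x y = 1) ->
  in_cohom_class Y ('Res[X] (cfRepr R)) beta.
Proof.
move=> sXY beta1; exists n, R, (fun _ _ => 1); split; last first.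
  by exists (fun=> 1) => [x _ | x y _ _]; rewrite ?oner_neq0 ?beta1 ?mul1r ?invr1.
split=> [y Yy||x y Yx Yy]; first exact: repr_mx_unit.
  by exists (subg_repr R sXY); rewrite ?cfRepr_sub.
by rewrite scale1r -repr_mxM.
Qed.

Section CohomIn.

Variables (aT : finGroupType) (A G N : {group aT}) (n k : nat).
Variables (R : mx_representation algC A n).
Variables (R' : mx_representation algC 'N_A(N) k).
Variables (chi : 'CF(G)) (psi : 'CF(N)).
Local Notation C := 'C_A(G)%G.
Hypotheses (nsGA : G <| A) (sNG : N \subset G) (nNG : 'N_G(N)%g \subset N).
Hypotheses (defA : A \subset (G * 'N_A(N))%g) (cAC : 'C_A(G)%g \subset 'Z(A)%g).
Hypotheses (irr_chi : chi \in irr G) (irr_psi : psi \in irr N).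
Hypotheses (Dchi : 'Res[G] (cfRepr R) = chi) (Dpsi : 'Res[N] (cfRepr R') = psi).
Hypothesis scalC :
  {in 'C_A(G)%g, forall c, exists l, R c = l%:M /\ R' c = l%:M}.
Hypothesis AutA : (conj_aut G @* A)%g = Aut_stab_char G G chi.

Let sGA : G \subset A := normal_sub nsGA.
Let sCA : C \subset A. Proof. exact: subsetIl. Qed.
Let sCB : C \subset 'N_A(N)%g.
Proof.
rewrite subsetI sCA (subset_trans cAC) // (subset_trans (subsetIr _ _)) //.
by rewrite (subset_trans (centS _) (cent_sub _)) // (subset_trans sNG).
Qed.
Let sNB : N \subset 'N_A(N)%g.
Proof. by rewrite subsetI normG (subset_trans sNG). Qed.
Let cGC : C \subset 'C(G)%g. Proof. exact: subsetIr. Qed.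
Let cNC : C \subset 'C(N)%g. Proof. exact: subset_trans cGC (centS sNG). Qed.
Let GCE : (G <*> C)%g = (G * C)%g. Proof. by rewrite cent_joinEr. Qed.
Let NCE : (N <*> C)%g = (N * C)%g. Proof. by rewrite cent_joinEr. Qed.
Let nsGCA : (G <*> C <| A)%g.
Proof.
apply: normalY => //; rewrite /normal sCA.
by rewrite (subset_trans _ (cent_sub _)) // centsC (subset_trans cAC) ?subsetIr.
Qed.

Let B := 'N_A(N)%G.
Let nsNCB : (N <*> C <| B)%g.
Proof.
apply: normalY; first by rewrite /normal sNB subsetIr.
rewrite /normal sCB.
rewrite (subset_trans _ (cent_sub _)) // (subset_trans (subsetIl _ _)) // centsC.
by rewrite (subset_trans cAC) ?subsetIr.
Qed.

(** The kernel of A -> Aut(G) / Inn(G) is G <*> C, as an element inducing an inner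
automorphism is a product of an element of G and one centralising G. *)
Lemma Out_isom :
  exists g : {morphism (A / (G <*> C))%g >-> coset_of (Inn G)},
    isom (A / (G <*> C)) (Out_stab_char chi) g /\
    {in A, forall a, g (coset (G <*> C) a) = coset (Inn G) (conj_aut G a)}.
Proof.
have nInnA a : a \in A -> conj_aut G a \in 'N(Inn G)%g.
  move=> Aa; have: (conj_aut G @* G <| conj_aut G @* A)%g by rewrite morphim_normal.
  case/andP=> _ /subsetP; apply; rewrite mem_morphim //.
  exact: subsetP (normal_norm nsGA) a Aa.
have fM : {in A &, {morph (fun a => coset (Inn G) (conj_aut G a)) : a b / (a * b)%g}}.
  move=> a b Aa Ab /=; rewrite morphM ?(subsetP (normal_norm nsGA)) //.
  by rewrite morphM ?nInnA.
have kerf : 'ker (Morphism fM) = (G <*> C)%g.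
  rewrite GCE; apply/setP=> a; apply/morphpreP/mulsgP.
    case=> Aa /set1P /= /coset_idr; rewrite nInnA // => /(_ isT)/morphimP[g _ Gg].
    move=> e; exists g (g^-1 * a)%g; rewrite ?mulKVg //.
    have Ag := subsetP sGA g Gg; have nG := subsetP (normal_norm nsGA).
    rewrite inE groupM ?groupV //= -ker_conj_aut.
    apply/morphpreP; rewrite groupM ?groupV ?nG //; split=> //.
    by rewrite !morphM ?morphV ?groupV ?nG //= e mulVg inE.
  case=> g c Gg Cc ->; have Ag := subsetP sGA g Gg.
  have Ac : c \in A := subsetP sCA c Cc.
  split; first by rewrite groupM.
  apply/set1P=> /=; apply: coset_id; rewrite morphM ?(subsetP (normal_norm nsGA)) //.
  have /morphpreP[_ /set1P ->] : c \in 'ker (conj_aut G).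
    by rewrite ker_conj_aut (subsetP cGC).
  by rewrite mulg1 mem_morphim ?(subsetP (normG G)).
have sk : 'ker (coset (G <*> C)) \subset 'ker (Morphism fM) by rewrite ker_coset kerf.
have sAN := normal_norm nsGCA.
pose g : {morphism (A / (G <*> C))%g >-> coset_of (Inn G)} := factm_morphism sk sAN.
exists g; split; last first.
  by move=> a Aa; exact: (factmE sk sAN Aa).
have <- : (g @* (A / (G <*> C)))%g = Out_stab_char chi.
  rewrite morphim_factm /Out_stab_char -AutA.
  apply/setP=> x; apply/morphimP/morphimP.
    case=> a _ Aa ->; exists (conj_aut G a) => //; first exact: nInnA.
    by rewrite mem_morphim // (subsetP (normal_norm nsGA)).
  by case=> _ _ /morphimP[a _ Aa ->] ->; exists a.
by apply/isomP; split=> //; apply/injm_factmP; rewrite kerf ker_coset.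
Qed.

(** Injectivity is the modular law and 'N_G(N) = N, surjectivity the factorisation
of A by G and 'N_A(N). *)
Lemma norm_quotient_isom :
  exists iota : {morphism ('N_A(N) / (N <*> C))%g >-> coset_of (G <*> C)},
    isom ('N_A(N) / (N <*> C)) (A / (G <*> C)) iota /\
    {in 'N_A(N)%g, forall a, iota (coset (N <*> C) a) = coset (G <*> C) a}.
Proof.
have sAN := normal_norm nsGCA; have sBN := normal_norm nsNCB.
have sBA : B \subset A by apply: subsetIl.
pose f := restrm_morphism (subset_trans sBA sAN) (coset_morphism (G <*> C)).
have kerf : 'ker f = (N <*> C)%g.
  rewrite ker_restrm ker_coset /= GCE NCE; apply/setP=> x; apply/setIP/mulsgP.
    case=> /setIP[Ax nNx] /mulsgP[g c Gg Cc Dx].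
    exists g c => //; apply: (subsetP nNG); rewrite inE Gg /=.
    rewrite -(mulgK c g) -Dx groupM ?groupV //.
    by have /setIP[] := subsetP sCB c Cc.
  case=> g c Ng Cc ->; split; last by rewrite mem_mulg ?(subsetP sNG).
  by rewrite groupM ?(subsetP sNB g) ?(subsetP sCB c).
have sk : 'ker (coset (N <*> C)) \subset 'ker f by rewrite ker_coset kerf.
pose g : {morphism (B / (N <*> C))%g >-> coset_of (G <*> C)} := factm_morphism sk sBN.
exists g; split; last by move=> a Ba; exact: (factmE sk sBN Ba).
have <- : (g @* (B / (N <*> C)))%g = (A / (G <*> C))%g.
  rewrite morphim_factm morphim_restrm setIid.
  apply/eqP; rewrite eqEsubset morphimS //=.
  apply/subsetP=> x /morphimP[a nGa Aa ->].
  have /mulsgP[g1 b Gg Bb Da] := subsetP defA a Aa.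
  have nGb := subsetP sAN b (subsetP sBA b Bb).
  have GCg : g1 \in (G <*> C)%g by rewrite (subsetP (joing_subl _ _)).
  have eab : coset (G <*> C) a = coset (G <*> C) b by rewrite Da mkerl ?ker_coset.
  suff: coset (G <*> C) a \in (coset (G <*> C) @* B)%g by [].
  rewrite eab.
  exact: mem_morphim.
by apply/isomP; split=> //; apply/injm_factmP; rewrite kerf ker_coset.
Qed.

(** The scalars by which C acts form the character epsilon, which is A-invariant
because C is central in A. *)
Lemma cohom_in_of_reprs : cohom_in A chi psi.
Proof.
have nz_n : n%:R != 0 :> algC.
  have [i Di] := irrP irr_chi.
  by have := irr1_neq0 i; rewrite -Di -Dchi cfRes1 cfRepr1.
have nz_k : k%:R != 0 :> algC.
  have [i Di] := irrP irr_psi.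
  by have := irr1_neq0 i; rewrite -Di -Dpsi cfRes1 cfRepr1.
have nK (d : algC) : d *+ n / n%:R = d by rewrite -[d *+ n]mulr_natr mulfK.
pose l c := \tr (R c) / n%:R.
have lE : {in C, forall c, R c = (l c)%:M /\ R' c = (l c)%:M}.
  move=> c /scalC[d [Rc R'c]]; rewrite /l Rc R'c mxtrace_scalar.
  by rewrite nK.
have lrepr : mx_repr C (fun c => (l c)%:M : 'M_1).
  split; first by rewrite /l repr_mx1 mxtrace1 divff.
  move=> c d Cc Cd /=; rewrite -scalar_mxM; congr _%:M.
  have [Rc _] := lE c Cc; have [Rd _] := lE d Cd.
  rewrite {1}/l repr_mxM ?(subsetP sCA) // Rc Rd -scalar_mxM mxtrace_scalar.
  by rewrite nK.
pose Leps := MxRepresentation lrepr.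
have lin_eps : cfRepr Leps \is a linear_char.
  by rewrite qualifE /= cfRepr_char cfRepr1 /=.
have [e De] := irrP (lin_char_irr lin_eps).
have epsE c : c \in C -> 'chi_e c = l c.
  by move=> Cc; rewrite -De cfunE Cc mulr1n mxtrace_scalar.
have ResC : 'Res[C] (cfRepr R) = n%:R *: 'chi_e.
  apply/cfun_inP=> c Cc; rewrite cfResE // cfunE (subsetP sCA) // mulr1n cfunE epsE //.
  by have [-> _] := lE c Cc; rewrite mxtrace_scalar mulr_natl.
have ResC' : 'Res[C] (cfRepr R') = k%:R *: 'chi_e.
  apply/cfun_inP=> c Cc; rewrite cfResE // cfunE (subsetP sCB) // mulr1n cfunE epsE //.
  by have [_ ->] := lE c Cc; rewrite mxtrace_scalar mulr_natl.
have sGCA := normal_sub nsGCA; have sNCB := normal_sub nsNCB.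
have [iota [isoi iotaE]] := norm_quotient_isom.
split=> //.
- rewrite (setIidPl _) //; apply/subsetP=> a Aa.
  rewrite inE (subsetP (normal_norm nsGA)) //= -Dchi.
  by rewrite (cfConjgRes _ (normal_refl A) nsGA Aa) cfConjg_id.
- exact: abelianS cAC (center_abelian A).
- exact: Out_isom.
exists e; split.
- rewrite (setIidPl _) // (subset_trans _ (cent_sub_inertia _)) // centsC.
  by rewrite (subset_trans cAC) ?subsetIr.
- have sZC : 'Z(G)%g \subset C by rewrite subsetI (subset_trans (center_sub G)) ?subsetIr.
  have lin_e : 'chi_e \is a linear_char by rewrite -De.
  have [z Dz] := irrP (lin_char_irr (cfRes_lin_char 'Z(G)%g lin_e)).
  rewrite (@Irr_belowZ _ 'Z(G)%G _ _ 1 z) ?oner_eq0 ?scale1r //.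
  rewrite (@Irr_belowZ _ 'Z(G)%G _ _ n%:R z) //.
  rewrite -Dchi cfResRes ?center_sub // -(cfResRes _ sZC sCA) ResC linearZ /=.
  by rewrite Dz.
exists ('Res (cfRepr R)), ('Res (cfRepr R')), iota; split=> //.
- have DG : 'Res[G] ('Res[G <*> C] (cfRepr R)) = chi by rewrite cfResRes ?joing_subl.
  split=> //; first by apply: (@cfRes_irr_irr _ _ G);
    rewrite ?DG // cfRes_char ?cfRepr_char.
  by apply: (Irr_belowZ nz_n); rewrite cfResRes ?joing_subr.
- have DN : 'Res[N] ('Res[N <*> C] (cfRepr R')) = psi by rewrite cfResRes ?joing_subl.
  split=> //; first by apply: (@cfRes_irr_irr _ _ N);
    rewrite ?DN // cfRes_char ?cfRepr_char.
  by apply: (Irr_belowZ nz_k); rewrite cfResRes ?joing_subr.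
by exists (fun _ _ => 1); split; apply: trivial_cohom_class.
Qed.

End CohomIn.

(** * The cohomological condition from linked projective representations *)

(** P and P' are projective representations of A and of 'N_A(N), extending linear
representations of G and N that afford chi and psi, with a common factor set
alpha and common scalars on 'C_A(G).  Having values in a finite group of roots
of unity makes the group generated by the matrices P y finite; alpha is
normalised to be trivial on G so that P conjugates the representation of G as
A does. *)
Definition linked_proj_reprs (gT : finGroupType) (G N A : {group gT})
    (chi : 'CF(G)) (psi : 'CF(N)) : Prop :=
  exists n k (P : gT -> 'M[algC]_n) (P' : gT -> 'M[algC]_k)
         (alpha : gT -> gT -> algC) m,
  [/\ exists2 rG : mx_representation algC G n, {in G, P =1 rG} & cfRepr rG = chi,
      exists2 rN : mx_representation algC N k, {in N, P' =1 rN} & cfRepr rN = psi,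
      {in A &, forall x y, P x *m P y = alpha x y *: P (x * y)%g},
      {in 'N_A(N)%g &, forall x y, P' x *m P' y = alpha x y *: P' (x * y)%g}
    & [/\ (0 < m)%N, {in A &, forall x y, alpha x y ^+ m = 1},
          {in G & A, forall g y, alpha g y = 1 /\ alpha y g = 1}
        & {in 'C_A(G)%g, forall z, exists c, P z = c%:M /\ P' z = c%:M}]].

Lemma Aut_stabP (gT : finGroupType) (G U : {set gT}) a :
  reflect (a \in Aut G /\ {in U, forall x, a x \in U}) (a \in Aut_stab G U).
Proof.
apply: (iffP setIP) => [[Aut_a aU] | [Aut_a aU]]; split=> //.
  move=> x Ux; move: aU; rewrite !inE => /subsetP/(_ x Ux).
  by rewrite inE.
by rewrite !inE; apply/subsetP=> x Ux; rewrite inE aU.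
Qed.

Lemma Aut_stab_charP (gT : finGroupType) (G U X : {set gT}) (phi : 'CF(X)) a :
  reflect [/\ a \in Aut G, {in U, forall x, a x \in U}
             & {in X, forall x, phi (a x) = phi x}]
          (a \in Aut_stab_char G U phi).
Proof.
rewrite /Aut_stab_char; apply: (iffP setIdP).
  case=> /Aut_stabP[Aut_a aU] /forall_inP phi_a; split=> // x Xx.
  exact/eqP/phi_a.
case=> Aut_a aU phi_a; split; first exact/Aut_stabP.
by apply/forall_inP=> x Xx; apply/eqP/phi_a.
Qed.

Lemma irr_of_morphim_eq (gT aT : finGroupType) (D H : {group gT})
    (f : {morphism D >-> aT}) (H' : {group aT}) (phi : 'CF(H)) (phi' : 'CF(H')) :
  H \subset D -> H' = (f @* H)%g :> {set aT} ->
  {in H, forall x, phi' (f x) = phi x} -> phi \in irr H -> phi' \in irr H'.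
Proof.
move=> sHD DH' phi'E irr_phi; have {}DH' : H' = (f @* H)%G by apply: group_inj.
subst H'; rewrite -(cfMorph_irr _ sHD) (_ : cfMorph phi' = phi) //.
by apply/cfun_inP=> x Hx; rewrite cfMorphE ?phi'E.
Qed.

Section Linked.

Variables (sT gT : finGroupType) (S : {group sT}) (G N A : {group gT}).
Variables (pi : {morphism G >-> sT}) (chi : 'CF(G)) (psi : 'CF(N)).
Hypothesis cover : maximal_perfect_central_extension S pi.
Hypotheses (nsGA : G <| A) (sNG : N \subset G) (nNG : 'N_G(N)%g \subset N).
Hypotheses (sZN : 'Z(G)%g \subset N) (defA : (G * 'N_A(N))%g = A).
Hypotheses (irr_chi : chi \in irr G) (irr_psi : psi \in irr N).
Hypothesis AutA : (conj_aut G @* A)%g = Aut_stab_char G G chi.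
Hypothesis Aut_chi_psi : Aut_stab_char G N chi = Aut_stab_char G N psi.

Variables (n k : nat) (P : gT -> 'M[algC]_n) (P' : gT -> 'M[algC]_k).
Variables (alpha : gT -> gT -> algC) (m : nat).
Variables (rG : mx_representation algC G n) (rN : mx_representation algC N k).
Hypotheses (PG : {in G, P =1 rG}) (rGchi : cfRepr rG = chi).
Hypotheses (PN : {in N, P' =1 rN}) (rNpsi : cfRepr rN = psi).
Hypothesis PM : {in A &, forall x y, P x *m P y = alpha x y *: P (x * y)%g}.
Hypothesis PM' :
  {in 'N_A(N)%g &, forall x y, P' x *m P' y = alpha x y *: P' (x * y)%g}.
Hypothesis m_gt0 : (0 < m)%N.
Hypothesis alphaX : {in A &, forall x y, alpha x y ^+ m = 1}.
Hypothesis alphaG : {in G & A, forall g y, alpha g y = 1 /\ alpha y g = 1}.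
Hypothesis scalC :
  {in 'C_A(G)%g, forall z, exists c, P z = c%:M /\ P' z = c%:M}.

Let perfG : [~: G, G]%g = G. Proof. by case: cover => [] []. Qed.
Let sGA : G \subset A := normal_sub nsGA.
Let nGA y : y \in A -> y \in 'N(G)%g.
Proof. exact: subsetP (normal_norm nsGA) y. Qed.

Let n_neq0 : n%:R != 0 :> algC.
Proof.
have [i Di] := irrP irr_chi.
by have := irr1_neq0 i; rewrite -Di -rGchi cfRepr1.
Qed.

Let trK (d : algC) : \tr (d%:M : 'M_n) / n%:R = d.
Proof. by rewrite mxtrace_scalar -[d *+ n]mulr_natr mulfK. Qed.

Let P1 : P 1%g = 1%:M. Proof. by rewrite PG ?repr_mx1. Qed.
Let P'1 : P' 1%g = 1%:M. Proof. by rewrite PN ?repr_mx1. Qed.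

Let root_neq0 (c : algC) : c ^+ m = 1 -> c != 0.
Proof. by apply: contra_eqN => /eqP->; rewrite expr0n gtn_eqF // eq_sym oner_eq0. Qed.

Let PV y : y \in A -> P y *m ((alpha y y^-1)^-1 *: P y^-1%g) = 1%:M.
Proof.
move=> Ay; rewrite -scalemxAr PM ?groupV // mulgV P1 scalerA mulVf ?scale1r //.
by rewrite root_neq0 // alphaX ?groupV.
Qed.

Let Punit y : y \in A -> P y \in unitmx.
Proof. by move/PV/mulmx1_unit; case. Qed.

Let PgM g y : g \in G -> y \in A -> P g *m P y = P (g * y)%g.
Proof.
by move=> Gg Ay; have Ag := subsetP sGA g Gg;
  rewrite PM // (proj1 (alphaG Gg Ay)) scale1r.
Qed.

Let PMg g y : g \in G -> y \in A -> P y *m P g = P (y * g)%g.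
Proof.
by move=> Gg Ay; have Ag := subsetP sGA g Gg;
  rewrite PM // (proj2 (alphaG Gg Ay)) scale1r.
Qed.

(* This is the well-definedness of c P(y) |-> c P'(y): if y and y' act in the    *)
(* same way on G, they differ by an element of 'C_A(G), and the matrices on       *)
(* both sides differ by the same scalar, which alpha and 'C_A(G) determine.       *)
Let P'_wd y y' c c' : y \in 'N_A(N)%g -> y' \in 'N_A(N)%g ->
  conj_aut G y = conj_aut G y' -> c *: P y = c' *: P y' -> c *: P' y = c' *: P' y'.
Proof.
move=> My My'; have /setIP[Ay _] := My; have /setIP[Ay' _] := My' => eyy' cPy.
have Cw : (y^-1 * y')%g \in 'C_A(G)%g.
  rewrite inE groupM ?groupV //= -ker_conj_aut.
  apply/morphpreP; rewrite groupM ?groupV ?nGA //; split=> //.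
  by rewrite !morphM ?morphV ?groupV ?nGA //= eyy' mulVg inE.
have [d [Pw P'w]] := scalC Cw.
have Mw : (y^-1 * y')%g \in 'N_A(N)%g by rewrite groupM ?groupV.
have Aw : (y^-1 * y')%g \in A by case/setIP: Mw.
set a := alpha y (y^-1 * y').
have nz_a : a != 0 by rewrite root_neq0 // alphaX.
have dP : d *: P y = a *: P y' by rewrite -mul_mx_scalar -Pw PM // mulKVg.
have dP' : d *: P' y = a *: P' y' by rewrite -mul_mx_scalar -P'w PM' // mulKVg.
have eP' : P' y' = (a^-1 * d) *: P' y by rewrite -scalerA dP' scalerA mulVf ?scale1r.
have eP : P y' = (a^-1 * d) *: P y by rewrite -scalerA dP scalerA mulVf ?scale1r.
rewrite eP' scalerA; congr (_ *: _).
move: cPy; rewrite eP scalerA => /(congr1 (mulmx^~ (invmx (P y)))).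
rewrite -!scalemxAl mulmxV ?Punit // !scalemx1 => e.
by rewrite -[LHS]trK e trK.
Qed.

(* As alpha takes its values in the m-th roots of unity, the matrices c P(y) with *)
(* c ^+ m = 1 are closed under products.                                         *)
Let finite_lift : exists (hT : finGroupType) (r : hT -> 'M[algC]_n),
  [/\ injective r, r 1%g = 1%:M, {morph r : x y / (x * y)%g >-> x *m y}
    & forall c y, c ^+ m = 1 -> y \in A -> exists x, r x = c *: P y].
Proof.
have [z prim_z] := C_prim_root_exists m_gt0.
pose s := [seq z ^+ i *: P y | i <- iota 0 m, y <- enum A].
have sP a : reflect (exists c y, [/\ c ^+ m = 1, y \in A & a = c *: P y]) (a \in s).
  apply: (iffP allpairsP) =>
    [[[i y] /= [_]] | [c [y [/(prim_rootP prim_z)[i ->] Ay ->]]]].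
    rewrite mem_enum => Ay ->; exists (z ^+ i), y; split=> //.
    by rewrite exprAC (prim_expr_order prim_z) expr1n.
  by exists (nat_of_ord i, y); split; rewrite //= ?mem_iota ?mem_enum ?add0n ?ltn_ord.
have [|||hT [r [rI r1 rM rS]]] := @finite_matrix_group n s; last first.
- by exists hT, r; split=> // c y c1 Ay; apply/rS/sP; exists c, y.
- move=> a /sP[c [y [c1 Ay ->]]].
  have nz_c := root_neq0 c1.
  have nz_a : alpha y y^-1 != 0 by rewrite root_neq0 ?alphaX ?groupV.
  have e : c *: P y *m ((c * alpha y y^-1)^-1 *: P y^-1%g) = 1%:M.
    by rewrite invfM -scalerA -scalemxAr -scalemxAl PV // scalerA mulVf ?scale1r.
  have [u _] := mulmx1_unit e; split=> //; apply/sP.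
  exists (c * alpha y y^-1)^-1, y^-1%g; rewrite groupV; split=> //.
    by rewrite exprVn exprMn c1 alphaX ?groupV // mulr1 invr1.
  by rewrite -[RHS](mulKmx u) e mulmx1.
- move=> a b /sP[c [y [c1 Ay ->]]] /sP[d [x [d1 Ax ->]]]; apply/sP.
  exists (c * d * alpha y x), (y * x)%g; rewrite groupM //; split=> //.
    by rewrite !exprMn c1 d1 alphaX // !mulr1.
  by rewrite -scalemxAl -scalemxAr PM // !scalerA ?mulrA.
- by apply/sP; exists 1, 1%g; rewrite expr1n group1 scale1r P1.
Qed.

Let stabA y g : y \in A -> g \in G -> chi (g ^ y)%g = chi g.
Proof.
move=> Ay Gg; have: conj_aut G y \in Aut_stab_char G G chi.
  by rewrite -AutA mem_morphim ?nGA.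
by rewrite inE => /andP[_ /forall_inP/(_ g Gg)/eqP]; rewrite norm_conj_autE ?nGA.
Qed.

(** The group A' of pairs (conj_aut G y, c P(y)), with h g = (conj_aut G g, P g).
The first component makes h have kernel in 'Z(G), even if chi is trivial; on
'Z(G) the second one has the kernel of the restriction of chi.  The subgroups
G' and N' are only known to be equal to the images of h, because the images of
G / K and N / K are such without being syntactically so. *)
Lemma linked_cohom_group :
  exists (aT : finGroupType) (A' : {group aT}) (h : {morphism G >-> aT}),
    'ker h = cfker ('Res['Z(G)%g] chi) /\
    forall (G' N' : {group aT}) (chi' : 'CF(G')) (psi' : 'CF(N')),
      G' = (h @* G)%g :> {set aT} -> N' = (h @* N)%g :> {set aT} ->
      {in G, forall x, chi' (h x) = chi x} ->
      {in N, forall x, psi' (h x) = psi x} -> cohom_in A' chi' psi'.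
Proof.
have [hT [r [rI r1 rM rS]]] := finite_lift.
pose aT : finGroupType := ({perm gT} * hT)%type.
pose L (b : aT) y c :=
  [/\ y \in A, c ^+ m = 1, b.1 = conj_aut G y & r b.2 = c *: P y].
pose cf (b : aT) y := \tr (r b.2 *m invmx (P y)) / n%:R.
pose lk (b : aT) y :=
  [&& y \in A, cf b y ^+ m == 1, b.1 == conj_aut G y & r b.2 == cf b y *: P y].
have LP b y c : L b y c -> lk b y /\ cf b y = c.
  case=> Ay c1 b1 b2; have e : cf b y = c.
    by rewrite /cf b2 -scalemxAl mulmxV ?Punit // scalemx1 trK.
  by split=> //; rewrite /lk Ay e c1 b1 b2 !eqxx.
have lkL b y : lk b y -> L b y (cf b y).
  by case/and4P=> Ay /eqP c1 /eqP b1 /eqP b2.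
pose A0 := [set b | [exists y, lk b y]].
have AP b : reflect (exists y c, L b y c) (b \in A0).
  rewrite inE; apply: (iffP existsP) => [[y /lkL Ly] | [y [c /LP[ly _]]]].
    by exists y, (cf b y).
  by exists y.
have Lext (b b' : aT) : b.1 = b'.1 -> r b.2 = r b'.2 -> b = b'.
  by case: b b' => [b1 b2] [c1 c2] /= -> /rI->.
have LM b y c b' y' c' : L b y c -> L b' y' c' ->
    L (b * b')%g (y * y')%g (c * c' * alpha y y').
  case=> Ay c1 b1 b2 [Ay' c1' b1' b2']; split.
  - exact: groupM.
  - by rewrite !exprMn c1 c1' alphaX // !mulr1.
  - by rewrite /= b1 b1' morphM ?nGA.
  by rewrite /= rM b2 b2' -scalemxAl -scalemxAr PM // !scalerA ?mulrA.
have A0gr : group_set A0.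
  apply/group_setP; split.
    apply/AP; exists 1%g, 1; split; rewrite ?expr1n ?morph1 //.
    by rewrite /= r1 scale1r P1.
  by move=> b b' /AP[y [c Lb]] /AP[y' [c' Lb']]; apply/AP; do 2!eexists; apply: LM Lb Lb'.
pose A' := Group A0gr.
pose e y : aT := (conj_aut G y, odflt 1%g [pick x | r x == P y]).
have eL y : y \in A -> L (e y) y 1.
  move=> Ay; split; rewrite ?expr1n //= scale1r.
  case: pickP => [x /eqP // | no]; have [x] := rS 1 y (expr1n _ _) Ay.
  by rewrite scale1r => /eqP; rewrite no.
have Le b y : y \in A -> b.1 = conj_aut G y -> r b.2 = P y -> b = e y.
  by move=> /eL[_ _ e1 e2] b1 b2; apply: Lext; rewrite ?e1 // e2 scale1r.
have AG g : g \in G -> g \in A by apply: subsetP sGA g.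
have eM : {in G &, {morph e : x y / (x * y)%g}}.
  move=> x y Gx Gy; apply/esym/Le; rewrite ?groupM ?AG //=.
    by rewrite morphM ?nGA ?AG.
  have [_ _ _ /= ex] := eL x (AG x Gx); have [_ _ _ /= ey] := eL y (AG y Gy).
  by rewrite rM ex ey !scale1r PgM ?AG.
pose h := Morphism eM.
have hL g : g \in G -> L (h g) g 1 by move=> Gg; apply/eL/AG.
have eA y : y \in A -> e y \in A' by move=> Ay; apply/AP; exists y, 1; apply: eL.
have hJ b y c g : L b y c -> g \in G -> (h g ^ b)%g = h (g ^ y)%g.
  case=> Ay c1 b1 b2 Gg; have Ggy : (g ^ y)%g \in G by rewrite memJ_norm ?nGA.
  have [Ag Agy] := (AG g Gg, AG _ Ggy).
  have [_ _ /= hg1 hg2] := hL g Gg; have [_ _ /= hgy1 hgy2] := hL _ Ggy.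
  suff e1 : (h g * b = b * h (g ^ y))%g by rewrite conjgE e1 mulKg.
  apply: Lext => /=.
    by rewrite b1 -!morphM ?nGA // -conjgC.
  rewrite !rM b2 hg2 hgy2 !scale1r -scalemxAl -scalemxAr.
  by rewrite (PgM Gg Ay) (PMg Ggy Ay) -conjgC.
have h1P g : g \in G -> reflect (g \in 'Z(G)%g /\ P g = 1%:M) (h g == 1%g).
  move=> Gg; have [_ _ hg1 hg2] := hL g Gg.
  apply: (iffP eqP) => [hg | [Zg Pg]].
    split; last by rewrite -[P g]scale1r -hg2 hg r1.
    rewrite inE Gg -ker_conj_aut; apply/morphpreP.
    by rewrite (subsetP (normG G)) //; split=> //; apply/set1P; rewrite /= -[LHS]hg1 hg.
  apply: Lext; last by rewrite hg2 Pg scale1r r1.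
  have /setIP[_] := Zg; rewrite -ker_conj_aut => /morphpreP[_ /set1P c1].
  by rewrite hg1 c1.
have kerhZ : 'ker h \subset 'Z(G)%g.
  by apply/subsetP=> g /morphpreP[Gg /set1P/eqP/(h1P g Gg)[]].
have kerh : 'ker h = cfker ('Res['Z(G)%g] chi).
  rewrite -rGchi -(cfRepr_sub rG (center_sub G)) cfker_repr.
  apply/setP=> g; apply/idP/rkerP => [kg | [Zg]].
    have /morphpreP[Gg /set1P/eqP/(h1P g Gg)[Zg Pg]] := kg.
    by split=> //=; rewrite -PG.
  have /setIP[Gg _] := Zg; rewrite /= -PG // => Pg.
  by apply/morphpreP; split=> //; apply/set1P/eqP/h1P.
exists aT, A', h; split=> // G' N' chi' psi' DG' DN' chi'E psi'E.
have G'h g : g \in G -> h g \in G' by move=> Gg; rewrite DG' mem_morphim.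
have N'h g : g \in N -> h g \in N'.
  by move=> Ng; rewrite DN' mem_morphim ?(subsetP sNG).
have G'P x : x \in G' -> exists2 g, g \in G & x = h g.
  by rewrite DG' => /morphimP[g _ Gg ->]; exists g.
have N'P x : x \in N' -> exists2 g, g \in N & x = h g.
  by rewrite DN' => /morphimP[g _ Gg ->]; exists g.
have sN'G' : N' \subset G' by rewrite DG' DN' morphimS.
have nsG'A' : G' <| A'.
  apply/andP; split; apply/subsetP.
    by move=> x /G'P[g Gg ->]; apply/eA/AG.
  move=> b /AP[y [c Lb]]; rewrite inE; apply/subsetP=> y' /imsetP[x /G'P[g Gg ->] ->].
  by rewrite (hJ _ _ _ _ Lb) // G'h // memJ_norm // nGA //; case: Lb.
have normP b y c : L b y c -> (b \in 'N(N')%g) = (y \in 'N(N)%g).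
  move=> Lb; apply/idP/idP => nN; rewrite inE; apply/subsetP=> y' /imsetP[].
    move=> g Ng ->; have Gg := subsetP sNG g Ng.
    have Ggy : (g ^ y)%g \in G by rewrite memJ_norm // nGA //; case: Lb.
    have: (h g ^ b)%g \in N' by rewrite memJ_norm ?N'h.
    rewrite (hJ _ _ _ _ Lb) // => /N'P[x Nx hx]; have Gx := subsetP sNG x Nx.
    rewrite -[(g ^ y)%g](mulgKV x) groupM // (subsetP sZN) // (subsetP kerhZ) //.
    apply/morphpreP; rewrite groupM ?groupV //; split=> //; apply/set1P.
    by rewrite morphM ?groupV // morphV // hx mulgV.
  move=> x /N'P[g Ng ->] ->; rewrite (hJ _ _ _ _ Lb) ?(subsetP sNG) // N'h //.
  by rewrite memJ_norm.
have CP b : b \in 'C_A'(G')%g -> exists y c d,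
    [/\ L b y c, y \in 'C_A(G)%g, P y = d%:M & P' y = d%:M].
  case/setIP=> /AP[y [c Lb]] /centP cGb; have [Ay _ _ _] := Lb.
  have Cy : y \in 'C_A(G)%g.
    rewrite inE Ay; apply: perfect_cent_mod_center; rewrite ?nGA // => g Gg.
    apply: (subsetP (subset_trans kerhZ (subsetIr _ _))).
    have Ggy : (g ^ y)%g \in G by rewrite memJ_norm // nGA.
    apply/morphpreP; rewrite commgEl groupM ?groupV //; split=> //; apply/set1P.
    rewrite morphM ?groupV // morphV // -(hJ _ _ _ _ Lb) // conjgE.
    by rewrite -[(h g * b)%g]cGb ?G'h // mulKg mulVg.
  by have [d [Py P'y]] := scalC Cy; exists y, c, d.
have Rrepr : mx_repr A' (fun b : aT => r b.2) by split=> // b b' _ _ /=.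
pose R := MxRepresentation Rrepr.
(* By [P'_wd] the choice of y is immaterial. *)
pose Q (b : aT) := if [pick y in 'N_A(N)%g | lk b y] is Some y
                   then cf b y *: P' y else 0.
have QE b y c : L b y c -> y \in 'N_A(N)%g -> Q b = c *: P' y.
  move=> Lb My; have [lkb _] := LP b y c Lb; have [_ _ b1 b2] := Lb.
  rewrite /Q; case: pickP => [x /andP[Mx /lkL[_ _ b1x b2x]] | /(_ y)];
    last by rewrite My lkb.
  by apply: P'_wd; rewrite // -?b1 -?b2.
have BP b : b \in 'N_A'(N')%g -> exists y c, L b y c /\ y \in 'N_A(N)%g.
  case/setIP=> /AP[y [c Lb]]; rewrite (normP _ _ _ Lb) => nNy.
  by exists y, c; rewrite inE nNy; case: (Lb) => ->.
have Qrepr : mx_repr 'N_A'(N')%G Q.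
  split.
    have L1 : L 1%g 1%g 1 by rewrite -(morph1 h); apply: hL.
    by rewrite (QE _ _ _ L1) ?group1 // scale1r P'1.
  move=> b b' /BP[y [c [Lb My]]] /BP[y' [c' [Lb' My']]].
  rewrite (QE _ _ _ Lb) // (QE _ _ _ Lb') // (QE _ _ _ (LM _ _ _ _ _ _ Lb Lb'))
    ?groupM //.
  by rewrite -scalemxAl -scalemxAr PM' // !scalerA ?mulrA.
pose R' := MxRepresentation Qrepr.
have sG'A' := normal_sub nsG'A'.
have sN'B' : N' \subset 'N_A'(N')%g by rewrite subsetI normG (subset_trans sN'G').
have Dchi : 'Res[G'] (cfRepr R) = chi'.
  apply/cfun_inP=> x G'x; rewrite cfResE // cfunE (subsetP sG'A') // mulr1n.
  have [g Gg ->] := G'P x G'x; have [_ _ _ /= ->] := hL g Gg.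
  by rewrite chi'E // -rGchi cfunE Gg mulr1n scale1r PG.
have Dpsi : 'Res[N'] (cfRepr R') = psi'.
  apply/cfun_inP=> x N'x; rewrite cfResE // cfunE (subsetP sN'B') // mulr1n.
  have [g Ng ->] := N'P x N'x; have Gg := subsetP sNG g Ng.
  rewrite /= (QE _ _ _ (hL g Gg)); last by rewrite inE AG // (subsetP (normG N)).
  by rewrite psi'E // -rNpsi cfunE Ng mulr1n scale1r PN.
apply: (@cohom_in_of_reprs aT A' G' N' n k R R') => //.
- apply/subsetP=> x /setIP[/G'P[g Gg ->]]; rewrite (normP _ _ _ (hL g Gg)) => nNg.
  by rewrite N'h // (subsetP nNG) // inE Gg.
- apply/subsetP=> b /AP[y [c Lb]]; have [Ay _ _ _] := Lb.
  have := Ay; rewrite -{1}defA => /mulsgP[g w Gg Mw Dy].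
  have Lgb := LM _ _ _ _ _ _ (hL _ (groupVr Gg)) Lb.
  apply/mulsgP; exists (h g) (h g^-1 * b)%g; rewrite ?G'h //.
    have Lgb' : (g^-1 * y)%g = w by rewrite Dy mulKg.
    rewrite inE (normP _ _ _ Lgb) Lgb'; case/setIP: Mw => _ ->; rewrite andbT.
    by apply/AP; do 2!eexists; apply: Lgb.
  by rewrite morphV // mulKVg.
- apply/subsetP=> b Cb; have [y [c [d [Lb Cy Py _]]]] := CP b Cb.
  have [Ay c1 b1 b2] := Lb; case/setIP: Cb => A'b _; rewrite inE A'b /=.
  apply/centP=> b' /AP[y' [c' [Ay' _ b1' b2']]]; apply: Lext => /=.
    have /morphpreP[_ /set1P e1] : y \in 'ker (conj_aut G).
      by rewrite ker_conj_aut; case/setIP: Cy.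
    by rewrite b1 [conj_aut G y]e1 mulg1 mul1g.
  by rewrite !rM b2 Py scale_scalar_mx scalar_mxC.
- exact: irr_of_morphim_eq (subxx G) DG' chi'E irr_chi.
- exact: irr_of_morphim_eq sNG DN' psi'E irr_psi.
- move=> b /CP[y [c [d [Lb Cy Py P'y]]]]; exists (c * d); split.
    by have [_ _ _ /= ->] := Lb; rewrite Py scale_scalar_mx.
  have /setIP[Ay cGy] := Cy.
  rewrite /= (QE _ _ _ Lb) ?P'y ?scale_scalar_mx // inE Ay.
  by rewrite (subsetP (cent_sub N)) // (subsetP (centS sNG)).
have AutP (a : {perm aT}) :
    reflect (a \in Aut G' /\ {in G', forall x, chi' (a x) = chi' x})
            (a \in Aut_stab_char G' G' chi').
  apply: (iffP (Aut_stab_charP _ _ _ _)) => [[] | [Aut_a chi'a]] //.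
  by split=> // x; apply: Aut_closed.
apply/setP=> a; apply/morphimP/AutP.
  case=> b nG'b /AP[y [c Lb]] ->; have [Ay _ _ _] := Lb.
  split; first exact: Aut_aut.
  move=> x /G'P[g Gg ->]; rewrite norm_conj_autE ?G'h // (hJ _ _ _ _ Lb) //.
  by rewrite !chi'E ?stabA // memJ_norm ?nGA.
case=> Aut_a chi'a.
have Aut_a' : a \in Aut (h @* G) by rewrite -DG'.
have [s Aut_s sE] := cover_lift_aut cover kerhZ Aut_a'.
have : s \in conj_aut G @* A.
  rewrite AutA; apply/Aut_stab_charP; split=> // x Gx; first exact: Aut_closed.
  by rewrite -!chi'E ?Aut_closed // sE // chi'a ?G'h.
case/morphimP=> y nGy Ay Ds; have A'y := eA y Ay.
have nG'y : e y \in 'N(G')%g := subsetP (normal_norm nsG'A') _ A'y.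
exists (e y) => //; apply: (eq_Aut Aut_a); first exact: Aut_aut.
move=> x /G'P[g Gg ->]; rewrite norm_conj_autE ?G'h // (hJ _ _ _ _ (eL y Ay)) //.
by rewrite -sE // Ds norm_conj_autE.
Qed.

Let nz_k : k%:R != 0 :> algC.
Proof.
have [i Di] := irrP irr_psi.
by have := irr1_neq0 i; rewrite -Di -rNpsi cfRepr1.
Qed.

Let Res_center : 'Res['Z(G)%g] psi = (k%:R / n%:R) *: 'Res['Z(G)%g] chi.
Proof.
apply/cfun_inP=> z Zz; have /setIP[Gz cGz] := Zz.
rewrite cfunE !cfResE ?center_sub // -rGchi -rNpsi !cfunE Gz (subsetP sZN) // !mulr1n.
have [d] : exists c, P z = c%:M /\ P' z = c%:M.
  by apply: scalC; rewrite inE (subsetP sGA).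
rewrite PG ?PN ?(subsetP sZN) // => -[-> ->]; rewrite !mxtrace_scalar.
by rewrite -[d *+ n]mulr_natr -[d *+ k]mulr_natr [d * n%:R]mulrC mulrA divfK // mulrC.
Qed.

Lemma cohom_of_projective : cohom chi psi.
Proof.
set K := cfker_group ('Res['Z(G)%g] chi).
have nz_a : k%:R / n%:R != 0 :> algC by rewrite mulf_neq0 ?invr_eq0.
have sKZ : K \subset 'Z(G)%g by apply: cfker_sub.
have nsKG : K <| G by rewrite sub_center_normal.
have nsKN : K <| N.
  by rewrite (normalS _ sNG nsKG) // (subset_trans sKZ).
have charK (X : {group gT}) (phi : 'CF(X)) : 'Z(G)%g \subset X ->
    phi \is a character ->
    (forall x, x \in K -> 'Res['Z(G)%g] phi x = 'Res['Z(G)%g] phi 1%g) ->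
    K \subset cfker phi.
  move=> sZX Nphi phiK; apply/subsetP=> x Kx; have Zx := subsetP sKZ x Kx.
  have := phiK x Kx; rewrite cfkerEchar // inE (subsetP sZX) // !cfResE //.
  by move->; rewrite eqxx.
have KP x : x \in K -> 'Res['Z(G)%g] chi x = 'Res['Z(G)%g] chi 1%g.
  by move=> /cfker1.
have sKchi : K \subset cfker chi.
  by apply: charK; rewrite ?center_sub ?irrWchar.
have sKpsi : K \subset cfker psi.
  apply: charK => //; first exact: irrWchar.
  by move=> x Kx; rewrite Res_center !cfunE KP.
split=> //.
  apply/setP=> i; rewrite !inE Res_center cfdotZl; congr (~~ _).
  by rewrite [RHS]mulf_eq0 (negPf nz_a).
have [aT [A' [h [kerh cohomA]]]] := linked_cohom_group.
have skh : 'ker (coset K) \subset 'ker h by rewrite ker_coset kerh.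
have nKG := normal_norm nsKG.
pose f : {morphism (G / K)%g >-> aT} := factm_morphism skh nKG.
have fE x : x \in G -> f (coset K x) = h x by apply: factmE.
have injf : 'injm f by apply/injm_factmP; rewrite kerh ker_coset.
have isoG : isom (G / K)%G (f @* (G / K))%G (restrm (subxx (G / K)%g) f).
  exact: (sub_isom (subxx _) (erefl _) injf).
have isoN : isom (N / K)%G (f @* (N / K))%G (restrm (quotientS K sNG) f).
  exact: (sub_isom (quotientS K sNG) (erefl _) injf).
exists aT, A', f, (cfIsom isoG (chi / K)%CF), (cfIsom isoN (psi / K)%CF).
have chi'E x : x \in G -> cfIsom isoG (chi / K)%CF (h x) = chi x.
  move=> Gx; rewrite -fE // -[f _]/(restrm (subxx (G / K)%g) f _).
  by rewrite cfIsomE ?mem_quotient // cfQuoE.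
have psi'E x : x \in N -> cfIsom isoN (psi / K)%CF (h x) = psi x.
  move=> Nx; rewrite -fE ?(subsetP sNG) //.
  rewrite -[f _]/(restrm (quotientS K sNG) f _).
  by rewrite cfIsomE ?mem_quotient // cfQuoE.
split=> //.
- apply/cfun_inP=> _ /morphimP[x _ Gx ->].
  by rewrite cfMorphE ?mem_quotient // fE // chi'E // cfQuoE.
- apply/cfun_inP=> _ /morphimP[x _ Nx ->].
  by rewrite cfMorphE ?mem_quotient ?quotientS // fE ?(subsetP sNG) // psi'E // cfQuoE.
apply: cohomA => //; first by rewrite /= morphim_factm.
by rewrite /= morphim_factm.
Qed.
End Linked.

Lemma cohom_of_linked (sT gT : finGroupType) (S : {group sT})
    (G N A : {group gT}) (pi : {morphism G >-> sT})
    (chi : 'CF(G)) (psi : 'CF(N)) :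
    maximal_perfect_central_extension S pi ->
    G <| A -> N \subset G -> 'N_G(N)%g \subset N -> 'Z(G)%g \subset N ->
    (G * 'N_A(N))%g = A -> chi \in irr G -> psi \in irr N ->
    (conj_aut G @* A)%g = Aut_stab_char G G chi ->
    Aut_stab_char G N chi = Aut_stab_char G N psi ->
    linked_proj_reprs A chi psi -> cohom chi psi.
Proof.
move=> cover nsGA sNG nNG sZN defA irr_chi irr_psi AutA Aut_chi_psi.
case=> n [k [P [P' [alpha [m [[rG PG rGchi] [rN PN rNpsi] PM PM' [m0 aX aG sC]]]]]]].
exact: (cohom_of_projective cover nsGA sNG nNG sZN defA irr_chi irr_psi AutA
  Aut_chi_psi PG rGchi PN rNpsi PM PM' m0 aX aG sC).
Qed.

(** * Clifford theory over an abelian quotient *)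

(** The induced characters of la from H and of 1 from X have a common constituent:
by Frobenius reciprocity their inner product is a positive multiple of
#|H :&: X|.  Such a constituent is linear, as Y / X is abelian. *)
Lemma lin_char_extension (gT : finGroupType) (X H Y : {group gT})
    (la : 'CF(H)) :
  X <| Y -> abelian (Y / X)%g -> H \subset Y -> la \is a linear_char ->
  H :&: X \subset cfker la ->
  exists mu : 'CF(Y),
    [/\ mu \is a linear_char, X \subset cfker mu & 'Res[H] mu = la].
Proof.
move=> nsXY abYX sHY lin_la kerla; have sXY := normal_sub nsXY.
have [l Dl] := irrP (lin_char_irr lin_la).
have nz : '['Ind[Y] la, 'Ind[Y, X] 1] != 0.
  rewrite -cfdot_Res_r cfInd_cfun1 // linearZ cfdotZr mulf_neq0 //.
    by rewrite conjC_eq0 pnatr_eq0 -lt0n indexg_gt0.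
  rewrite cfdotE (bigID (mem X)) /= [X in _ + X]big1 ?addr0 => [|x /andP[Hx /negPf nXx]].
    rewrite (eq_bigr (fun=> 1)) => [|x /andP[Hx Xx]].
      rewrite mulf_neq0 ?invr_eq0 ?neq0CG // sumr_const pnatr_eq0 -lt0n.
      by apply/card_gt0P; exists 1%g; rewrite unfold_in /= !group1.
    rewrite cfResE // cfuniE // Xx conjC1 mulr1.
    by rewrite cfker1 ?lin_char1 // (subsetP kerla) // inE Hx.
  by rewrite cfResE // cfuniE // nXx conjC0 mulr0.
have [j nz_j] : exists j, ('['Ind[Y] la, 'chi_j] != 0) && ('['Ind[Y, X] 1, 'chi_j] != 0).
  apply/existsP; apply: contraNT nz => /existsPn no; rewrite cfdot_sum_irr.
  apply/eqP/big1=> i _; apply/eqP; rewrite mulf_eq0 conjC_eq0.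
  by have := no i; rewrite negb_and !negbK.
have /andP[laj oneXj] := nz_j.
have kerj : X \subset cfker 'chi_j.
  by apply: constt0_Res_cfker; rewrite // -constt_Ind_Res irr0; exact: oneXj.
have lin_j : 'chi_j \is a linear_char.
  rewrite -(cfQuoK nsXY kerj) cfMod_lin_char //.
  by rewrite -quo_IirrE //; apply/char_abelianP.
exists 'chi_j; split=> //.
have : l \in irr_constt ('Res[H] 'chi_j) by rewrite -constt_Ind_Res -Dl; exact: laj.
have [k Dk] := irrP (lin_char_irr (cfRes_lin_char H lin_j)).
by rewrite Dk constt_irr inE Dl => /eqP->.
Qed.

Section Clifford.

Variables (gT : finGroupType) (X Y : {group gT}) (t : Iirr X).
Hypotheses (nsXY : X <| Y) (abYX : abelian (Y / X)%g).
Hypothesis ext_t : extends_to 'I_Y['chi_t] 'chi_t.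

Local Notation T := 'I_Y['chi_t]%G.
Let sXY := normal_sub nsXY.
Let sTY : T \subset Y. Proof. exact: subsetIl. Qed.
Let nsXT : X <| T. Proof. exact: normal_Inertia. Qed.
Let abTX : abelian (T / X)%g.
Proof. exact: abelianS (quotientS X sTY) abYX. Qed.

Let inT k : 'Res[X, T] 'chi_k = 'chi_t -> k \in irr_constt ('Ind[T] 'chi_t).
Proof. by move=> Rk; rewrite constt_Ind_Res Rk constt_irr inE. Qed.

(** This is the uniqueness in the Clifford correspondence. *)
Lemma ext_Ind_inj k k' :
  'Res[X, T] 'chi_k = 'chi_t -> 'Res[X, T] 'chi_k' = 'chi_t ->
  'Ind[Y] 'chi_k = 'Ind[Y] 'chi_k' -> k = k'.
Proof.
move=> /inT Ak /inT Ak' eI; have [_ inj _ _ _] := constt_Inertia_bijection t nsXY.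
by apply: inj => //; rewrite /Ind_Iirr eI.
Qed.

Lemma constt_Ind_extP k s : 'Res[X, T] 'chi_k = 'chi_t ->
  s \in irr_constt ('Ind[T] 'chi_t) ->
  exists mu : 'CF(T), [/\ mu \is a linear_char, X \subset cfker mu &
    'chi_s = 'chi_k * mu].
Proof.
move=> Rk; have [irrM _ im _] := constt_Ind_ext nsXT Rk.
rewrite im => /codomP[b ->]; exists ('chi_b %% X)%CF; split.
- by apply: cfMod_lin_char; apply/char_abelianP.
- exact: cfker_mod.
by rewrite cfIirrE ?irrM // mod_IirrE // mulrC.
Qed.

Lemma constt_Ind_ext_Ind i : i \in irr_constt ('Ind[Y] 'chi_t) ->
  exists2 k, 'Res[X, T] 'chi_k = 'chi_t & 'chi_i = 'Ind[Y] 'chi_k.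
Proof.
have [c Rc] := ext_t; have [irrI _ im _ _] := constt_Inertia_bijection t nsXY.
rewrite -im => /imsetP[s As ->]; exists s; last by rewrite cfIirrE // irrI.
have [mu [lin_mu kermu ->]] := constt_Ind_extP Rc As.
rewrite rmorphM /= Rc cfRes_sub_ker // lin_char1 // scale1r.
by rewrite mulr1.
Qed.

Lemma constt_Ind_lin_orbit i j :
  i \in irr_constt ('Ind[Y] 'chi_t) -> j \in irr_constt ('Ind[Y] 'chi_t) ->
  exists mu : 'CF(Y),
    [/\ mu \is a linear_char, X \subset cfker mu & 'chi_j = 'chi_i * mu].
Proof.
move=> /constt_Ind_ext_Ind[k Rk ->] /constt_Ind_ext_Ind[k' Rk' ->].
have [nu [lin_nu kernu ->]] := constt_Ind_extP Rk (inT Rk').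
have kernu' : T :&: X \subset cfker nu by rewrite subIset ?kernu ?orbT.
have [mu [lin_mu kermu Rmu]] := lin_char_extension nsXY abYX sTY lin_nu kernu'.
by exists mu; split; rewrite // -Rmu cfIndM.
Qed.

(** By the Clifford correspondence mu fixes the extension of 'chi_t that induces
to 'chi_i, and then Gallagher's theorem says that mu is trivial on T. *)
Lemma constt_Ind_mul_lin i (mu : 'CF(Y)) :
  mu \is a linear_char -> X \subset cfker mu ->
  'chi_i * mu = 'chi_i -> i \in irr_constt ('Ind[Y] 'chi_t) ->
  T \subset cfker mu.
Proof.
move=> lin_mu kermu eI /constt_Ind_ext_Ind[k Rk Di]; move: eI;
  rewrite Di -cfIndM // => eI.
have irrM : 'chi_k * 'Res[T] mu \in irr T.
  by rewrite mulrC mul_lin_irr ?cfRes_lin_char ?mem_irr.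
have [k' Dk'] := irrP irrM.
have Rk' : 'Res[X, T] 'chi_k' = 'chi_t.
  rewrite -Dk' rmorphM /= Rk (cfResRes _ (normal_sub nsXT) sTY) cfRes_sub_ker //.
  by rewrite lin_char1 // scale1r mulr1.
have ek : k' = k by apply: ext_Ind_inj => //; rewrite -Dk'.
have kerT : X \subset cfker ('Res[T] mu).
  by rewrite cfker_Res ?lin_charW // subsetI normal_sub.
have [b Db] := irrP (lin_char_irr (cfRes_lin_char T lin_mu)).
have [_ injM _ _] := constt_Ind_ext nsXT Rk.
have b0 : quo_Iirr X b = 0.
  apply: injM; apply: irr_inj; rewrite /mul_mod_Iirr quo_IirrK -?Db //.
  rewrite mod_Iirr0 /mul_Iirr irr0 mul1r irrK -Db mulrC Dk' ek cfIirrE //.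
  exact: mem_irr.
have Rmu1 : 'Res[T] mu = 1.
  by rewrite Db -(quo_IirrK nsXT (i := b)) -?Db // b0 mod_Iirr0 irr0.
have := cfker_Res sTY (lin_charW lin_mu).
by rewrite Rmu1 cfker_cfun1 => /esym/setIidPl.
Qed.

Lemma constt_Ind_mul_lin_fix i (mu : 'CF(Y)) :
  mu \is a linear_char -> T \subset cfker mu ->
  i \in irr_constt ('Ind[Y] 'chi_t) -> 'chi_i * mu = 'chi_i.
Proof.
move=> lin_mu kermu /constt_Ind_ext_Ind[k Rk ->]; rewrite -cfIndM //.
by rewrite cfRes_sub_ker // lin_char1 // scale1r mulr1.
Qed.

(** Both sides are extensions of 'chi_t to T with the same induced character. *)
Lemma ext_conj_twist k h (mu : 'CF(Y)) :
  'Res[X, T] 'chi_k = 'chi_t -> h \in 'N(Y)%g -> h \in 'I['chi_t] ->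
  mu \is a linear_char -> X \subset cfker mu ->
  ('Ind[Y] 'chi_k ^ h)%CF = 'Ind[Y] 'chi_k * mu ->
  ('chi_k ^ h)%CF = 'chi_k * 'Res[T] mu.
Proof.
move=> Rk nYh Ih lin_mu ker_mu eI; have nXh := subsetP (norm_inertia _) h Ih.
have nTh : h \in 'N(T)%g.
  have sN : ('N(Y) :&: 'I['chi_t] \subset 'N(T))%g.
    by apply: normsI; rewrite ?subsetIl // normsG ?subsetIr.
  by apply: (subsetP sN); rewrite inE nYh.
have irrM : 'chi_k * 'Res[T] mu \in irr T.
  by rewrite mulrC mul_lin_irr ?cfRes_lin_char ?mem_irr.
have [k' Dk'] := irrP irrM; rewrite Dk' -conjg_IirrE; congr 'chi_ _.
apply: ext_Ind_inj.
- by rewrite conjg_IirrE -cfConjgRes_norm // Rk inertiaJ.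
- rewrite -Dk' rmorphM /= Rk (cfResRes _ (normal_sub nsXT) sTY) cfRes_sub_ker //.
  by rewrite lin_char1 // scale1r mulr1.
by rewrite conjg_IirrE -cfConjgInd_norm // eI -Dk' cfIndM.
Qed.

End Clifford.

(** * Gluing representations into projective ones *)

Lemma irr_repr_cent_scalar (gT : finGroupType) (X : {group gT}) n
    (rX : mx_representation algC X n) (B : 'M_n) :
  cfRepr rX \in irr X -> {in X, forall x, B *m rX x = rX x *m B} ->
  exists b, B = b%:M.
Proof.
move=> /irr_reprP[r irr_r Dr] cBX.
have sim : mx_rsim r rX by apply: cfRepr_inj; rewrite Dr.
have abs_rX : mx_absolutely_irreducible rX by apply/groupC/(mx_rsim_irr sim).
apply/is_scalar_mxP/(mx_abs_irr_cent_scalar abs_rX).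
by apply/centgmxP=> x Xx; rewrite cBX.
Qed.

(** A matrix intertwining r1 and r2 commutes with the irreducible representation
of X, so it is a scalar. *)
Lemma repr_extension_inj (gT : finGroupType) (X T : {group gT}) n
    (r1 r2 : mx_representation algC T n) :
  X \subset T -> 'Res[X] (cfRepr r1) \in irr X -> {in X, r1 =1 r2} ->
  cfRepr r1 = cfRepr r2 -> {in T, r1 =1 r2}.
Proof.
move=> sXT irrX eqX /cfRepr_inj[B _ freeB simB].
have [b Db] : exists b, B = b%:M.
  apply: (irr_repr_cent_scalar (rX := subg_repr r1 sXT)); rewrite ?cfRepr_sub //.
  by move=> x Xx /=; rewrite simB ?(subsetP sXT) // eqX.
move=> t Tt; have := simB t Tt; rewrite [in RHS]Db -scalar_mxC -Db => e.
have uB : B \in unitmx by rewrite -row_free_unit.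
by rewrite -[LHS](mulmxK uB) e mulmxK.
Qed.

(** Conjugating the second representation by a matrix intertwining the
restrictions to X makes these equal, not only similar. *)
Lemma compatible_reprs (gT : finGroupType) (X T L : {group gT})
    (phi1 : 'CF(T)) (phi2 : 'CF(L)) :
  X \subset T -> X \subset L -> phi1 \is a character -> phi2 \is a character ->
  'Res[X] phi1 = 'Res[X] phi2 ->
  exists n (r1 : mx_representation algC T n) (r2 : mx_representation algC L n),
    [/\ cfRepr r1 = phi1, cfRepr r2 = phi2 & {in X, r1 =1 r2}].
Proof.
move=> sXT sXL /char_reprP[[n1 r1] ->] /char_reprP[[n2 r2] ->] /= eqR.
have : cfRepr (subg_repr r1 sXT) = cfRepr (subg_repr r2 sXL) by rewrite !cfRepr_sub.
case/cfRepr_inj=> B en freeB simB; subst n2.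
have uB : B \in unitmx by rewrite -row_free_unit.
exists n1, r1, (rconj_repr r2 uB); split=> //.
  by apply/cfRepr_sim; exists B => // x Lx; rewrite rconj_mxE mulmxKV.
by move=> x Xx; rewrite rconj_mxE; apply: (can_inj (mulmxK uB));
  rewrite mulmxKV //; apply: simB.
Qed.

Section Gluing.

Variables (gT : finGroupType) (X T L : {group gT}) (n : nat).
Variables (r1 : mx_representation algC T n) (r2 : mx_representation algC L n).
Hypotheses (sXT : X \subset T) (sXL : X \subset L) (eqX : {in X, r1 =1 r2}).
Hypothesis irrX : 'Res[X] (cfRepr r1) \in irr X.

(** The representations t |-> r2(h)^-1 r1(h t h^-1) r2(h) and t |-> la(t) r1(t)
afford the same character and coincide on X. *)
Lemma conj_twist h (la : 'CF(T)) :
  h \in L -> h \in 'N(T)%g -> h \in 'N(X)%g -> la \is a linear_char ->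
  X \subset cfker la -> (cfRepr r1 ^ h)%CF = cfRepr r1 * la ->
  {in T, forall t, r2 h *m r1 t = (la t)^-1 *: (r1 (t ^ h^-1)%g *m r2 h)}.
Proof.
move=> Lh nTh nXh lin_la ker_la chi_h.
have nTh' t : t \in T -> (t ^ h^-1)%g \in T by move=> Tt; rewrite memJ_norm ?groupV.
have nXh' t : t \in X -> (t ^ h^-1)%g \in X by move=> Tt; rewrite memJ_norm ?groupV.
have r1L t : t \in X -> r1 t = r2 t := eqX (x := t).
have rh : r2 h \in unitmx by apply: repr_mx_unit.
have Yrepr : mx_repr T (fun t => la t *: r1 t).
  split; first by rewrite lin_char1 // scale1r repr_mx1.
  move=> s t Ts Tt; rewrite lin_charM // repr_mxM //.
  by rewrite -scalemxAl -scalemxAr scalerA.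
have Wrepr : mx_repr T (fun t => invmx (r2 h) *m r1 (t ^ h^-1)%g *m r2 h).
  split; first by rewrite conj1g repr_mx1 mulmx1 mulVmx.
  move=> s t Ts Tt; rewrite conjMg repr_mxM ?nTh' // !mulmxA.
  by rewrite mulmxK.
pose W := MxRepresentation Wrepr; pose Y := MxRepresentation Yrepr.
have WX t : t \in X -> W t = r1 t.
  move=> Xt; rewrite /= r1L ?nXh' // r1L // conjgE invgK.
  rewrite !repr_mxM ?groupM ?groupV ?(subsetP sXL t) //.
  by rewrite repr_mxV // !mulmxA mulmxKV // mulVmx // mul1mx.
have cfW : cfRepr W = cfRepr Y.
  apply/cfun_inP=> t Tt; rewrite !cfunE Tt !mulr1n /= mxtraceZ.
  rewrite -mulmxA mxtrace_mulC -mulmxA mulmxV // mulmx1.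
  have := congr1 (fun phi : 'CF(T) => phi t) chi_h.
  by rewrite cfConjgE // !cfunE Tt nTh' // !mulr1n mulrC.
have irrW : 'Res[X] (cfRepr W) \in irr X.
  rewrite (_ : 'Res[X] _ = 'Res[X] (cfRepr r1)) //; apply/cfun_inP=> x Xx.
  by rewrite !cfResE // !cfunE (subsetP sXT) // !mulr1n WX.
have WY : {in T, W =1 Y}.
  apply: (repr_extension_inj sXT irrW _ cfW) => x Xx.
  by rewrite WX //= cfker1 ?(subsetP ker_la) // lin_char1 // scale1r.
move=> t Tt; have /= e := WY t Tt.
have -> : r1 (t ^ h^-1)%g *m r2 h = la t *: (r2 h *m r1 t).
  by rewrite scalemxAr -e -[in RHS]mulmxA mulKVmx.
by rewrite scalerA mulVf ?scale1r // lin_char_neq0.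
Qed.

Variables (T0 K : {group gT}) (la : gT -> 'CF(T)).
Hypotheses (sTT0 : T \subset T0) (sKL : K \subset L) (tiTK : T0 :&: K \subset X).
Hypotheses (nTK : K \subset 'N(T)) (nXK : K \subset 'N(X)).
Hypothesis laP : {in K, forall h, [/\ la h \is a linear_char,
  X \subset cfker (la h) & (cfRepr r1 ^ h)%CF = cfRepr r1 * la h]}.

(** The factors of y are taken in the possibly larger product T0 * K, so that the
same factors serve for two groups T and T0 at once. *)
Definition glue_repr y := r1 (divgr T0 K y) *m r2 (remgr T0 K y).
Local Notation P := glue_repr.

Let KT0 h : h \in K -> divgr T0 K h \in X.
Proof.
move=> Kh; have TKh : h \in (T0 * K)%g by rewrite -[h]mul1g mem_mulg.
apply: (subsetP tiTK); rewrite inE mem_divgr // /divgr groupM ?groupV //.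
exact: mem_remgr.
Qed.

Lemma glue_repr_mul t h : t \in T -> h \in K -> P (t * h)%g = r1 t *m r2 h.
Proof.
move=> Tt Kh; have T0t := subsetP sTT0 t Tt.
have TKh : h \in (T0 * K)%g by rewrite -[h]mul1g mem_mulg.
rewrite /P remgrMl // divgrMl // repr_mxM ?(subsetP sXT _ (KT0 Kh)) //.
rewrite (eqX (KT0 Kh)) -mulmxA -repr_mxM ?(subsetP sXL _ (KT0 Kh)) //.
  by rewrite -divgr_eq.
exact: subsetP sKL _ (mem_remgr TKh).
Qed.

Lemma mem_glue_factors y : y \in (T * K)%g -> divgr T0 K y \in T /\ remgr T0 K y \in K.
Proof.
case/mulsgP=> t h Tt Kh ->; have T0t := subsetP sTT0 t Tt.
rewrite divgrMl // groupM ?(subsetP sXT _ (KT0 Kh)) // remgrMl //; split=> //.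
by apply: mem_remgr; rewrite -[h]mul1g mem_mulg.
Qed.

(** The factor set depends on r1 only through the linear characters la h; two
glued representations with the same la have the same factor set. *)
Lemma glue_reprM : {in (T * K)%g &, forall x y,
  P x *m P y = (la (remgr T0 K x) (divgr T0 K y))^-1 *: P (x * y)%g}.
Proof.
move=> x y TKx TKy; have [Tt Kh] := mem_glue_factors TKx;
  have [Tt' Kh'] := mem_glue_factors TKy.
have e0 (a b c d : gT) : (a * b * (c * d) = a * c ^ b^-1 * (b * d))%g.
  by rewrite conjgE invgK !mulgA mulgKV.
have main t h t' h' : t \in T -> h \in K -> t' \in T -> h' \in K ->
    r1 t *m r2 h *m (r1 t' *m r2 h') = (la h t')^-1 *: P (t * h * (t' * h'))%g.
  move=> {}Tt {}Kh {}Tt' {}Kh'.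
  have [lin_h ker_h chi_h] := laP Kh.
  have Lh := subsetP sKL h Kh; have nTh := subsetP nTK h Kh.
  have nXh := subsetP nXK h Kh.
  have Tth : (t' ^ h^-1)%g \in T by rewrite memJ_norm ?groupV.
  rewrite e0 glue_repr_mul ?(groupM Tt Tth) ?(groupM Kh Kh') //.
  rewrite (repr_mxM r1 Tt Tth) repr_mxM ?(subsetP sKL h') //.
  rewrite -mulmxA (mulmxA (r2 h)) (conj_twist Lh nTh nXh lin_h ker_h chi_h) //.
  by rewrite -scalemxAl -scalemxAr !mulmxA.
by rewrite {1 2}/P main // -!divgr_eq.
Qed.

Lemma glue_repr_id g : g \in X -> P g = r1 g.
Proof.
move=> Xg; rewrite -[g in LHS]mulg1 glue_repr_mul ?(subsetP sXT) //.
by rewrite repr_mx1 mulmx1.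
Qed.

Lemma glue_reprMl g y : g \in X -> y \in (T * K)%g -> P (g * y)%g = P g *m P y.
Proof.
move=> Xg /mulsgP[t h Tt Kh ->]; have Tg := subsetP sXT g Xg.
by rewrite mulgA !glue_repr_mul ?groupM // glue_repr_id // repr_mxM // mulmxA.
Qed.

Lemma glue_reprMr g y : g \in X -> y \in (T * K)%g -> P (y * g)%g = P y *m P g.
Proof.
move=> Xg /mulsgP[t h Tt Kh ->]; have nXh := subsetP nXK h Kh.
have Xgh : (g ^ h^-1)%g \in X by rewrite memJ_norm ?groupV.
have Tgh := subsetP sXT _ Xgh; have Lh := subsetP sKL h Kh.
have Lg := subsetP sXL g Xg.
have -> : (t * h * g)%g = (t * g ^ h^-1 * h)%g.
  by rewrite conjgE invgK !mulgA mulgKV.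
rewrite (glue_repr_mul (groupM Tt Tgh) Kh) (glue_repr_mul Tt Kh) glue_repr_id //.
have Lgh := subsetP sXL _ Xgh.
rewrite (repr_mxM r1 Tt Tgh) (eqX Xgh) (eqX Xg) -!mulmxA; congr (_ *m _).
by rewrite -(repr_mxM r2 Lgh Lh) -(repr_mxM r2 Lh Lg) conjgE invgK mulgA mulgKV.
Qed.

End Gluing.

Lemma scale_unitmx_id n (a : algC) (M : 'M_n) :
  (n%:R : algC) != 0 -> M \in unitmx -> a *: M = M -> a = 1.
Proof.
move=> nz_n uM /(congr1 (mulmx^~ (invmx M))); rewrite -scalemxAl mulmxV //.
move/(congr1 mxtrace); rewrite scalemx1 !mxtrace_scalar -[a *+ n]mulr_natr.
by rewrite -[RHS]mul1r => /(mulIf nz_n).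
Qed.

(** Here T * HN and NT * HN are the stabilisers; P is glued from representations
affording chi1 and chi2, P' from representations affording psi1 and psi2. *)
Lemma linked_of_extensions (gT : finGroupType) (G N A T H NT HN : {group gT})
    (chi : 'CF(G)) (psi : 'CF(N))
    (chi1 : 'CF(T)) (chi2 : 'CF(H)) (psi1 : 'CF(NT)) (psi2 : 'CF(HN)) :
    G <| A -> N \subset G -> G \subset T -> T <| A -> G \subset H -> HN \subset H ->
    HN \subset A -> N \subset HN -> NT \subset T -> N <| NT ->
    HN \subset 'N(NT)%g -> HN \subset 'N(N)%g ->
    (T * HN)%g = A -> (NT * HN)%g = 'N_A(N)%g -> T :&: HN \subset N ->
    chi1 \is a character -> chi2 \is a character ->
    psi1 \is a character -> psi2 \is a character ->
    'Res[G] chi1 = chi -> 'Res[G] chi2 = chi -> chi \in irr G ->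
    'Res[N] psi1 = psi -> 'Res[N] psi2 = psi -> psi \in irr N ->
    {in HN, forall h, exists la : 'CF(T),
       [/\ la \is a linear_char, G \subset cfker la,
           (chi1 ^ h)%CF = chi1 * la & (psi1 ^ h)%CF = psi1 * 'Res[NT] la]} ->
    {in 'C_A(G)%g, forall z,
       z \in NT /\ chi1 z / chi1 1%g = psi1 z / psi1 1%g} ->
  linked_proj_reprs A chi psi.
Proof.
move=> nsGA sNG sGT nsTA sGH sHNH sHNA sNHN sNTT nsNNT nNTHN nNHN defA defM tiTN.
move=> Nchi1 Nchi2 Npsi1 Npsi2 Rchi1 Rchi2 irr_chi Rpsi1 Rpsi2 irr_psi twist centr.
have sNNT := normal_sub nsNNT.
have eqRG : 'Res[G] chi1 = 'Res[G] chi2 by rewrite Rchi1 Rchi2.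
have [n [X1 [X2 [DX1 DX2 eqX]]]] := compatible_reprs sGT sGH Nchi1 Nchi2 eqRG.
have eqRN : 'Res[N] psi1 = 'Res[N] psi2 by rewrite Rpsi1 Rpsi2.
have [k [Y1 [Y2 [DY1 DY2 eqY]]]] := compatible_reprs sNNT sNHN Npsi1 Npsi2 eqRN.
have irrX : 'Res[G] (cfRepr X1) \in irr G by rewrite DX1 Rchi1.
have irrY : 'Res[N] (cfRepr Y1) \in irr N by rewrite DY1 Rpsi1.
have nz_n : n%:R != 0 :> algC.
  have [i Di] := irrP irrX.
  by have := irr1_neq0 i; rewrite -Di cfRes1 cfRepr1.
have nz_k : k%:R != 0 :> algC.
  have [i Di] := irrP irrY.
  by have := irr1_neq0 i; rewrite -Di cfRes1 cfRepr1.
have /fin_all_exists[la laP] : forall h, exists la : 'CF(T), h \in HN ->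
    [/\ la \is a linear_char, G \subset cfker la,
        (chi1 ^ h)%CF = chi1 * la & (psi1 ^ h)%CF = psi1 * 'Res[NT] la].
  move=> h; have [/twist[la Hla] | _] := boolP (h \in HN); first by exists la.
  by exists 0.
have sTA := normal_sub nsTA; have nTA := normal_norm nsTA.
have nTHN := subset_trans sHNA nTA; have nGHN := subset_trans sHNA (normal_norm nsGA).
have nsGT : G <| T by rewrite /normal sGT (subset_trans sTA) ?normal_norm.
have laX : {in HN, forall h, [/\ la h \is a linear_char,
    G \subset cfker (la h) & (cfRepr X1 ^ h)%CF = cfRepr X1 * la h]}.
  by move=> h /laP[]; rewrite DX1.
have laY : {in HN, forall h, [/\ 'Res[NT] (la h) \is a linear_char,
    N \subset cfker ('Res[NT] (la h)) &
    (cfRepr Y1 ^ h)%CF = cfRepr Y1 * 'Res[NT] (la h)]}.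
  move=> h /laP[lin_h ker_h _]; rewrite DY1 => ->; split=> //.
    exact: cfRes_lin_char.
  by rewrite cfker_Res ?lin_charW // subsetI sNNT (subset_trans sNG).
have tiTG : T :&: HN \subset G := subset_trans tiTN sNG.
pose P := glue_repr X1 X2 T HN; pose P' := glue_repr Y1 Y2 T HN.
have PM := glue_reprM sGT sGH eqX irrX (subxx T) sHNH tiTG nTHN nGHN laX.
have P'M := glue_reprM sNNT sNHN eqY irrY sNTT (subxx HN) tiTN nNTHN nNHN laY.
rewrite defA in PM; rewrite defM in P'M.
have AE y : y \in A -> divgr T HN y \in T /\ remgr T HN y \in HN.
  by rewrite -defA; apply: (mem_glue_factors sGT (subxx T) tiTG).
have ME y : y \in 'N_A(N)%g -> divgr T HN y \in NT /\ remgr T HN y \in HN.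
  by rewrite -defM; apply: (mem_glue_factors sNNT sNTT tiTN).
have Punit y : y \in A -> P y \in unitmx.
  move=> /AE[Tt Kh]; rewrite unitmx_mul !repr_mx_unit //.
  exact: subsetP sHNH _ Kh.
have GA g : g \in G -> g \in A := subsetP (normal_sub nsGA) g.
have Pg g : g \in G -> P g = X1 g.
  exact: (glue_repr_id sGT sGH eqX (subxx T) sHNH tiTG).
have P'g g : g \in N -> P' g = Y1 g.
  exact: (glue_repr_id sNNT sNHN eqY sNTT (subxx HN) tiTN).
exists n, k, P, P', (fun x y => (la (remgr T HN x) (divgr T HN y))^-1), #|T|.
split=> //.
- exists (subg_repr X1 sGT) => [g Gg|]; first exact: Pg.
  by rewrite cfRepr_sub DX1.
- exists (subg_repr Y1 sNNT) => [g Ng|]; first exact: P'g.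
  by rewrite cfRepr_sub DY1.
- move=> x y Mx My; rewrite P'M //; congr (_^-1 *: _); have [NTy _] := ME y My.
  by rewrite cfResE.
split=> //.
- move=> x y /AE[_ Kh] /AE[Tt _]; have [lin_h _ _ _] := laP _ Kh.
  rewrite exprVn -(divnK (order_dvdG Tt)) mulnC exprM.
  by rewrite (lin_char_unity_root lin_h Tt) expr1n invr1.
- move=> g y Gg Ay; have Ag := GA g Gg; split; apply: (scale_unitmx_id nz_n).
  + by apply: (Punit (g * y)%g); rewrite groupM.
  + rewrite -PM //; apply/esym.
    by apply: (glue_reprMl sGT sGH eqX (subxx T) sHNH tiTG); rewrite ?defA.
  + by apply: (Punit (y * g)%g); rewrite groupM.
  rewrite -PM //; apply/esym.
  by apply: (glue_reprMr sGT sGH eqX (subxx T) sHNH tiTG nGHN); rewrite ?defA.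
move=> z Cz; have [NTz ez] := centr z Cz; have /setIP[Az cGz] := Cz.
have Tz := subsetP sNTT z NTz.
have Pz : P z = X1 z.
  have := glue_repr_mul sGT sGH eqX (subxx T) sHNH tiTG Tz (group1 HN).
  by rewrite mulg1 repr_mx1 mulmx1.
have P'z : P' z = Y1 z.
  have := glue_repr_mul sNNT sNHN eqY sNTT (subxx HN) tiTN NTz (group1 HN).
  by rewrite mulg1 repr_mx1 mulmx1.
have [a Da] : exists a, X1 z = a%:M.
  apply: (irr_repr_cent_scalar (rX := subg_repr X1 sGT)); rewrite ?cfRepr_sub //.
  move=> g Gg /=; have Tg := subsetP sGT g Gg.
  by rewrite -!repr_mxM // (centP cGz).
have [b Db] : exists b, Y1 z = b%:M.
  apply: (irr_repr_cent_scalar (rX := subg_repr Y1 sNNT)); rewrite ?cfRepr_sub //.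
  move=> g Ng /=; have NTg := subsetP sNNT g Ng.
  by rewrite -!repr_mxM // (centP cGz) // (subsetP sNG).
exists a; rewrite Pz P'z Da Db; split=> //; congr _%:M.
move: ez; rewrite -DX1 -DY1 !cfRepr1 !cfunE Tz NTz !mulr1n Da Db !mxtrace_scalar.
by rewrite -[a *+ n]mulr_natr -[b *+ k]mulr_natr !mulfK.
Qed.

(** * Equivariant bijections from matched orbits *)

(** The relation B matches the R-orbits of SI with those of SJ, and matched points
have equal stabilisers.  Choosing a representative i in each orbit of SI and a
matched j, the map sending i x to j x is well defined. *)
Lemma equivariant_bijection (gT : finGroupType) (R : {group gT})
    (I J : finType) (aI : I -> gT -> I) (aJ : J -> gT -> J)
    (SI : {set I}) (SJ : {set J}) (B : I -> J -> Prop) (j0 : J) :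
    (forall i, aI i 1%g = i) ->
    (forall i, {in R &, forall x y, aI i (x * y)%g = aI (aI i x) y}) ->
    (forall j, aJ j 1%g = j) ->
    (forall j, {in R &, forall x y, aJ j (x * y)%g = aJ (aJ j x) y}) ->
    {in R & SI, forall x i, aI i x \in SI} ->
    (forall i j, B i j -> j \in SJ) ->
    (forall i j, B i j -> {in R, forall x, B (aI i x) (aJ j x)}) ->
    (forall i j, B i j -> {in R, forall x, aI i x = i <-> aJ j x = j}) ->
    {in SI, forall i, exists j, B i j} ->
    {in SJ, forall j, exists2 i, i \in SI & B i j} ->
    (forall i j i' j', B i j -> B i' j' ->
       (exists2 x, x \in R & aI i x = i') <-> (exists2 x, x \in R & aJ j x = j')) ->
  exists om : I -> J,
    [/\ {in SI &, injective om}, om @: SI = SJ,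
        {in R & SI, forall x i, om (aI i x) = aJ (om i) x}
      & {in SI, forall i, B i (om i)}].
Proof.
move=> aI1 aIM aJ1 aJM stSI BSJ BJ Bstab exJ exI Borb.
pose orb i i' := [exists x in R, aI i x == i'].
have orbP i i' : reflect (exists2 x, x \in R & aI i x = i') (orb i i').
  by apply: (iffP exists_inP) => -[x Rx /eqP]; exists x => //; apply/eqP.
have orb_refl i : orb i i by apply/orbP; exists 1%g.
have orb_eq i x : x \in R -> orb (aI i x) =1 orb i.
  move=> Rx i'; apply/orbP/orbP=> -[y Ry <-].
    by exists (x * y)%g; rewrite ?groupM ?aIM.
  by exists (x^-1 * y)%g; rewrite ?groupM ?groupV // -aIM ?groupM ?groupV // mulKVg.
pose rep i := choose (orb i) i.
have repJ i x : x \in R -> rep (aI i x) = rep i.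
  move=> Rx; rewrite /rep (eq_choose (orb_eq i x Rx)); apply: choose_id => //.
  by apply/orbP; exists x.
have /fin_all_exists[f fP] : forall i, exists j, i \in SI -> B i j.
  by move=> i; have [/exJ[j Bij] | _] := boolP (i \in SI); [exists j | exists j0].
have /fin_all_exists[y yP] : forall i, exists y, y \in R /\ aI (rep i) y = i.
  move=> i; have /orbP[x Rx Di] : orb i (rep i) by apply: chooseP.
  by exists x^-1%g; rewrite groupV -Di -aIM ?groupV // mulgV.
have repS i : i \in SI -> rep i \in SI.
  move=> Si; have [Ry Di] := yP i; rewrite -[rep i]aI1 -(mulgV (y i)).
  by rewrite aIM ?groupV // Di stSI ?groupV.
pose om i := aJ (f (rep i)) (y i).
have Bom : {in SI, forall i, B i (om i)}.
  move=> i Si; have [Ry Di] := yP i; rewrite -[i in B i _]Di.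
  by apply: BJ => //; apply/fP/repS.
have omJ : {in R & SI, forall x i, om (aI i x) = aJ (om i) x}.
  move=> x i Rx Si; have [Ry Di] := yP i; have [Ryx Dix] := yP (aI i x).
  rewrite /om repJ // in Dix *; set r := rep i in Di Dix *.
  have Br : B r (f r) by apply/fP/repS.
  set z := (y (aI i x) * (y i * x)^-1)%g.
  have Rz : z \in R by rewrite !(groupM, groupV).
  have Ryix : (y i * x)%g \in R by rewrite groupM.
  have rz : aI r z = r.
    have e : aI i x = aI r (y i * x)%g by rewrite aIM // Di.
    by rewrite aIM ?groupV // Dix e -aIM ?groupV // mulgV aI1.
  rewrite -aJM // -[in RHS](proj1 (Bstab _ _ Br z Rz) rz) -aJM //.
  by rewrite /z mulgKV.
exists om; split=> //.
- move=> i i' Si Si' e; have [_ [|x Rx Di']] := Borb _ _ _ _ (Bom i Si) (Bom i' Si').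
    by exists 1%g; rewrite ?aJ1.
  rewrite -Di' in e *; rewrite omJ // in e.
  by apply/esym/(Bstab _ _ (Bom i Si)).
apply/setP=> j; apply/imsetP/idP=> [[i Si ->] | /exI[i Si Bij]].
  exact: BSJ (Bom i Si).
have [orbIJ _] := Borb _ _ _ _ (Bom i Si) Bij.
have [|x Rx Dj] := orbIJ; first by exists 1%g.
by exists (aI i x); rewrite ?stSI ?omJ.
Qed.

(** * Conjugate characters, characters below, and central characters *)

Section Conj.

Variables (gT : finGroupType) (X : {group gT}).
Implicit Types i j : Iirr X.

Lemma mem_inertia_Iirr i y :
  y \in 'N(X)%g -> (y \in 'I['chi_i]) = (conjg_Iirr i y == i).
Proof. by move=> nXy; rewrite inE nXy -conjg_IirrE (inj_eq irr_inj). Qed.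

Lemma conjg_Iirr1 i : conjg_Iirr i 1%g = i.
Proof. by apply: irr_inj; rewrite conjg_IirrE cfConjgJ1. Qed.

Lemma conjg_IirrM i :
  {in 'N(X)%g &, forall x y, conjg_Iirr i (x * y)%g = conjg_Iirr (conjg_Iirr i x) y}.
Proof. by move=> x y nXx nXy; apply: irr_inj; rewrite !conjg_IirrE cfConjgMnorm. Qed.

Lemma conjg_Iirr_id i x : x \in X -> conjg_Iirr i x = i.
Proof. by move=> Xx; apply: irr_inj; rewrite conjg_IirrE cfConjg_id. Qed.

Lemma conjg_Irr_p' p i y : (conjg_Iirr i y \in Irr_p' p X) = (i \in Irr_p' p X).
Proof. by rewrite !inE conjg_IirrE cfConjg1. Qed.

End Conj.

Section Below.

Variables (gT : finGroupType) (X Y : {group gT}).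
Hypothesis nsXY : X <| Y.

Lemma Irr_belowE (i : Iirr Y) (i0 : Iirr X) : (i0 \in Irr_below X 'chi_i) = (i \in
  irr_constt ('Ind[Y] 'chi_i0)).
Proof. by rewrite inE constt_Ind_Res. Qed.

(** The restriction of 'chi_i is a multiple of the sum of one conjugacy class. *)
Lemma Irr_below_conj (i : Iirr Y) (i0 i1 : Iirr X) :
  i0 \in Irr_below X 'chi_i -> i1 \in Irr_below X 'chi_i ->
  exists2 y, y \in Y & conjg_Iirr i0 y = i1.
Proof.
rewrite !in_set => b0; rewrite (Clifford_Res_sum_cfclass nsXY b0) irr_consttE.
have [/cfclassP[y Yy D1] _ | n01] := boolP ('chi_i1 \in ('chi_i0 ^: Y)%CF).
  by exists y => //; apply: irr_inj; rewrite conjg_IirrE.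
case/negP; apply/eqP;
  rewrite cfdotZl reindex_cfclass //= cfdot_suml big1 ?mulr0 // => k ck.
rewrite cfdot_irr; case: eqP => // Dk; case/negP: n01; rewrite -Dk.
by move: ck; rewrite ?cfclass_IirrE.
Qed.

Lemma Irr_below_conjg (i : Iirr Y) (i0 : Iirr X) y :
  y \in 'N(X)%g -> y \in 'N(Y)%g -> i0 \in Irr_below X 'chi_i ->
  conjg_Iirr i0 y \in Irr_below X 'chi_(conjg_Iirr i y).
Proof.
move=> nXy nYy; rewrite !inE !conjg_IirrE -cfConjgRes_norm //.
by rewrite cfConjg_iso.
Qed.

Lemma Irr_over_below p (i : Iirr Y) (i0 : Iirr X) : i0 \in Irr_below X 'chi_i ->
  (i \in Irr_over_p' p X Y) = (i0 \in Irr_p' p X).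
Proof.
move=> b0; rewrite in_set; apply/subsetP/idP => [-> // | p'i0 i1 b1].
by have [y _ <-] := Irr_below_conj b0 b1; rewrite conjg_Irr_p'.
Qed.

Lemma exists_below (i : Iirr Y) : exists i0, i0 \in Irr_below X 'chi_i.
Proof.
have /neq0_has_constt[i0 b0] := Res_irr_neq0 X i.
by exists i0; rewrite in_set.
Qed.

Lemma exists_above (i0 : Iirr X) : exists i : Iirr Y, i0 \in Irr_below X 'chi_i.
Proof.
have [i ci] := constt_cfInd_irr i0 (normal_sub nsXY).
by exists i; rewrite Irr_belowE.
Qed.

(** Conjugacy of characters of X becomes, one level up, equality up to a linear
character of Y / X. *)
Lemma clifford_orbit (i i' : Iirr Y) (i0 i0' : Iirr X) :
  abelian (Y / X)%g -> extends_to 'I_Y['chi_i0'] 'chi_i0' ->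
  i0 \in Irr_below X 'chi_i -> i0' \in Irr_below X 'chi_i' ->
  (exists2 y, y \in Y & conjg_Iirr i0 y = i0') <->
  (exists mu : 'CF(Y), [/\ mu \is a linear_char, X \subset cfker mu
                         & 'chi_i' = 'chi_i * mu]).
Proof.
move=> abYX ext_i0' b0 b0'; split=> [[y Yy Di0'] | [mu [lin_mu ker_mu Di']]].
  apply: (constt_Ind_lin_orbit nsXY abYX ext_i0'); rewrite -Irr_belowE //.
  rewrite -Di0' -(conjg_Iirr_id i Yy); apply: Irr_below_conjg => //.
    exact: subsetP (normal_norm nsXY) y Yy.
  exact: subsetP (normG Y) y Yy.
apply: (Irr_below_conj b0); move: b0'; rewrite !in_set Di' rmorphM /=.
by rewrite (cfRes_sub_ker ker_mu) lin_char1 // scale1r mulr1.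
Qed.

End Below.

(** A subgroup containing X is normal with abelian quotient, hence the intersection
of the kernels of the linear characters that are trivial on it. *)
Lemma subset_lin_char_annihilator (gT : finGroupType) (X Y I J : {group gT}) :
  X <| Y -> abelian (Y / X)%g -> X \subset I -> I \subset Y -> J \subset Y ->
  (forall mu : 'CF(Y), mu \is a linear_char -> X \subset cfker mu ->
     I \subset cfker mu -> J \subset cfker mu) ->
  J \subset I.
Proof.
move=> nsXY abYX sXI sIY sJY ann.
have sY'X : (Y^`(1) \subset X)%g by rewrite der1_min ?normal_norm.
have nsIY : I <| Y by apply: sub_der1_normal sIY; apply: subset_trans sXI.
rewrite -(cap_cfker_normal nsIY); apply/bigcapsP=> k kerI; apply: ann => //.
  by rewrite lin_irr_der1 (subset_trans sY'X) // (subset_trans sXI).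
exact: subset_trans kerI.
Qed.

Lemma cfInd_center_ratio (gT : finGroupType) (H Y : {group gT}) (phi : 'CF(H)) z :
  H \subset Y -> z \in 'C(Y)%g ->
  'Ind[Y] phi z / 'Ind[Y] phi 1%g = phi z / phi 1%g.
Proof.
move=> sHY cYz.
have Iz x : x \in 'C(Y)%g -> 'Ind[Y] phi x = #|H|%:R^-1 * (phi x * #|Y|%:R).
  move=> cYx; rewrite cfIndE //; congr (_ * _).
  by rewrite mulr_natr -sumr_const; apply: eq_bigr => y Yy;
    rewrite conjgE (centP cYx y Yy) mulKg.
rewrite !Iz ?group1 //.
have nzH : #|H|%:R^-1 != 0 :> algC by rewrite invr_eq0 neq0CG.
by rewrite -mulf_div divff // mul1r -mulf_div divff ?neq0CG // mulr1.
Qed.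

(** The class of 'chi_nu under Y is a singleton, as Z is central in Y. *)
Lemma irr_center_ratio (gT : finGroupType) (Z Y : {group gT}) (nu : Iirr Z) (i :
  Iirr Y) z :
  Z \subset Y -> Y \subset 'C(Z)%g -> i \in Irr_above Y nu -> z \in Z ->
  'chi_i z / 'chi_i 1%g = 'chi_nu z.
Proof.
move=> sZY cZY; rewrite in_set constt_Ind_Res => bnu Zz.
have nsZY : Z <| Y by rewrite /normal sZY (subset_trans cZY) ?cent_sub.
have := Clifford_Res_sum_cfclass nsZY bnu.
rewrite cfclass_invariant ?(subset_trans cZY) ?cent_sub_inertia // big_seq1.
set c := '[_, _]; move=> RZ.
have RZz x : x \in Z -> 'chi_i x = c * 'chi_nu x.
  by move=> Zx; rewrite -(cfResE _ sZY Zx) RZ cfunE.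
have abZ : abelian Z by apply: subset_trans sZY cZY.
have := irr1_neq0 i; rewrite !RZz ?group1 // (lin_char1 (char_abelianP _ abZ nu)) mulr1.
by move=> nz_c; rewrite mulrC mulKf.
Qed.

Lemma linked_proj_reprs_conj (gT : finGroupType) (G N A : {group gT})
    (chi : 'CF(G)) (psi : 'CF(N)) y :
  y \in 'N(G)%g -> y \in 'N(N)%g -> linked_proj_reprs A chi psi ->
  linked_proj_reprs (A :^ y)%G (chi ^ y)%CF (psi ^ y)%CF.
Proof.
move=> nGy nNy [n [k [P [P' [al [m [[rG PG rGchi] [rN PN rNpsi] PM PM' [m0 aX aG
  sC]]]]]]]].
have conjV (B : {group gT}) x : x \in (B :^ y)%g -> (x ^ y^-1)%g \in B.
  by rewrite mem_conjg.
have Gc x : x \in G -> (x ^ y^-1)%g \in G by move=> Gx; rewrite memJ_norm ?groupV.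
have Nc x : x \in N -> (x ^ y^-1)%g \in N by move=> Gx; rewrite memJ_norm ?groupV.
have Mc x : x \in 'N_(A :^ y)(N)%g -> (x ^ y^-1)%g \in 'N_A(N)%g.
  case/setIP=> Ax nNx; rewrite inE conjV //=.
  by rewrite groupJr ?groupV.
have Cc x : x \in 'C_(A :^ y)(G)%g -> (x ^ y^-1)%g \in 'C_A(G)%g.
  case/setIP=> Ax cGx; rewrite inE conjV //=.
  by rewrite memJ_norm // groupV (subsetP (norms_cent (subxx _))).
have rGy : mx_repr G (fun x => rG (x ^ y^-1)%g).
  by split=> [|a b Ga Gb]; rewrite ?conj1g ?repr_mx1 // conjMg repr_mxM ?Gc.
have rNy : mx_repr N (fun x => rN (x ^ y^-1)%g).
  by split=> [|a b Ga Gb]; rewrite ?conj1g ?repr_mx1 // conjMg repr_mxM ?Nc.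
exists n, k, (fun x => P (x ^ y^-1)%g), (fun x => P' (x ^ y^-1)%g).
exists (fun a b => al (a ^ y^-1)%g (b ^ y^-1)%g), m; split.
- exists (MxRepresentation rGy) => [g Gg | ]; first by rewrite /= PG ?Gc.
  by apply/cfun_inP=> g Gg; rewrite cfConjgE // -rGchi !cfunE Gg Gc.
- exists (MxRepresentation rNy) => [g Gg | ]; first by rewrite /= PN ?Nc.
  by apply/cfun_inP=> g Gg; rewrite cfConjgE // -rNpsi !cfunE Gg Nc.
- by move=> a b Aa Ab /=; rewrite conjMg PM ?conjV.
- by move=> a b Ma Mb /=; rewrite conjMg PM' ?Mc.
split=> //.
- by move=> a b Aa Ab /=; rewrite aX ?conjV.
- by move=> g a Gg Aa /=; apply: aG; rewrite ?Gc ?conjV.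
by move=> z /Cc/sC.
Qed.

(** * Groups and characters in the situation of the criterion *)

Section Criterion.

Variables (p : nat) (gT : finGroupType) (G Q Gt D GD N : {group gT}).
Hypothesis Q_sylow : p.-Sylow(G) Q.
Hypothesis G_normal_Gt : G <| Gt.
Hypothesis GD_sdprod : (Gt ><| D)%g = GD.
Hypothesis Gt_G_abelian : abelian (Gt / G).
Hypothesis cent_G : 'C_GD(G)%g = 'Z(Gt)%g.
Hypothesis G_normal_GD : G <| GD.
Hypothesis N_stable : 'N_GD(Q)%g \subset 'N(N)%g.
Hypothesis norm_Q_N : 'N_G(Q)%g \subset N.
Hypothesis sNG : N \subset G.

Local Notation R := 'N_GD(Q)%G.
Local Notation M := 'N_GD(N)%G.
Local Notation NT := 'N_Gt(N)%G.

Let Gt_normal_GD : Gt <| GD. Proof. by case/sdprod_context: GD_sdprod. Qed.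

Let sGtGD := normal_sub Gt_normal_GD.
Let sGGt := normal_sub G_normal_Gt.
Let sGGD := normal_sub G_normal_GD.
Let nGGD := normal_norm G_normal_GD.
Let nGtGD := normal_norm Gt_normal_GD.

Let sQN : Q \subset N.
Proof.
by rewrite (subset_trans _ norm_Q_N) // subsetI (pHall_sub Q_sylow) normG.
Qed.

Let Q_sylow_N : p.-Sylow(N) Q.
Proof. exact: pHall_subl sQN sNG Q_sylow. Qed.

Let mulGR : (G * R)%g = GD.
Proof. exact: Frattini_arg G_normal_GD Q_sylow. Qed.

Let sRM : R \subset M.
Proof. by rewrite subsetI subsetIl N_stable. Qed.

Let nsNM : N <| M.
Proof. by rewrite /normal subsetIr subsetI normG (subset_trans sNG). Qed.

Let mulNR : (N * R)%g = M.
Proof.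
apply/eqP; rewrite eqEsubset mul_subG ?sRM ?(normal_sub nsNM) //=.
rewrite -(Frattini_arg nsNM Q_sylow_N) mulgS //.
by rewrite setSI // subsetIl.
Qed.

Let nNG : 'N_G(N)%g \subset N.
Proof.
have nsNN : N <| 'N_G(N)%g by rewrite /normal subsetIr subsetI sNG normG.
rewrite -(Frattini_arg nsNN Q_sylow_N) mul_subG //.
by apply: subset_trans norm_Q_N; rewrite setSI // subsetIl.
Qed.

Let sZN : 'Z(G)%g \subset N.
Proof.
apply: subset_trans norm_Q_N; rewrite setIS //.
by rewrite (subset_trans (centS (pHall_sub Q_sylow))) ?cent_sub.
Qed.

Let sNTM : NT \subset M. Proof. by rewrite setSI. Qed.

Let nsNNT : N <| NT.
Proof. by rewrite /normal subsetIr subsetI normG (subset_trans sNG). Qed.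

Let NT_N_abelian : abelian (NT / N).
Proof.
apply: sub_der1_abelian; apply: subset_trans nNG; rewrite subsetI.
have sG' : (Gt^`(1) \subset G)%g by rewrite der1_min ?normal_norm.
rewrite (subset_trans (dergS 1 (subsetIl _ _)) sG') /=.
exact: subset_trans (der_sub 1 _) (subsetIr _ _).
Qed.

Let NTG_N : NT :&: G \subset N.
Proof. by apply: subset_trans nNG; rewrite setIC setIS // subsetIr. Qed.

Let sZNT : 'Z(Gt)%g \subset NT.
Proof.
rewrite subsetI center_sub -cent_G (subset_trans (subsetIr _ _)) //.
by rewrite (subset_trans (centS sNG)) ?cent_sub.
Qed.

Let cZNT : NT \subset 'C('Z(Gt))%g.
Proof. by rewrite centsC (subset_trans (subsetIr _ _)) // centS // subsetIl. Qed.

(** The group G acts trivially on the characters of G and of Gt. *)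
Lemma conj_R y : y \in GD -> exists2 r, r \in R &
  (forall i : Iirr G, conjg_Iirr i y = conjg_Iirr i r) /\
  (forall i : Iirr Gt, conjg_Iirr i y = conjg_Iirr i r).
Proof.
rewrite -mulGR => /mulsgP[g r Gg Rr ->]; exists r => //; have /setIP[GDr _] := Rr.
have GDg := subsetP sGGD g Gg; have Gtg := subsetP sGGt g Gg.
have [nGg nGr] := (subsetP nGGD g GDg, subsetP nGGD r GDr).
have [nGtg nGtr] := (subsetP nGtGD g GDg, subsetP nGtGD r GDr).
by split=> i; rewrite conjg_IirrM // (@conjg_Iirr_id _ _ _ g).
Qed.

Let nNTM : M \subset 'N(NT)%g.
Proof.
apply: normsI; first by rewrite (subset_trans (subsetIl _ _)).
by rewrite (subset_trans (subsetIr _ _)) ?normG.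
Qed.

Lemma conj_R_M y : y \in M -> exists2 r, r \in R &
  [/\ forall i : Iirr G, conjg_Iirr i y = conjg_Iirr i r,
      forall i : Iirr N, conjg_Iirr i y = conjg_Iirr i r,
      forall i : Iirr Gt, conjg_Iirr i y = conjg_Iirr i r
    & forall i : Iirr NT, conjg_Iirr i y = conjg_Iirr i r].
Proof.
rewrite -{1}mulNR => /mulsgP[g r Ng Rr ->]; exists r => //.
have GDr : r \in GD by case/setIP: Rr.
have Gg := subsetP sNG g Ng; have GDg := subsetP sGGD g Gg.
have Gtg := subsetP sGGt g Gg.
have nNr := subsetP N_stable r Rr.
have nN_g : g \in 'N(N)%g := subsetP (normG N) g Ng.
have NTg : g \in NT := subsetP (normal_sub nsNNT) g Ng.
have Mr := subsetP sRM r Rr.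
have nNTr := subsetP nNTM r Mr.
have [nGg nGr] := (subsetP nGGD g GDg, subsetP nGGD r GDr).
have [nGtg nGtr] := (subsetP nGtGD g GDg, subsetP nGtGD r GDr).
have NTnNT := subsetP (normG NT) g NTg.
by split=> i; rewrite conjg_IirrM // (@conjg_Iirr_id _ _ _ g).
Qed.

Lemma conj_R_Gt : {in Gt, forall t, exists2 r, r \in R &
  forall i : Iirr G, conjg_Iirr i t = conjg_Iirr i r}.
Proof. by move=> t /(subsetP sGtGD)/conj_R[r Rr [e _]]; exists r. Qed.

Lemma mem_nR r : r \in R -> [/\ r \in 'N(G)%g, r \in 'N(N)%g, r \in 'N(Gt)%g
  & r \in 'N(NT)%g].
Proof.
move=> Rr; have GDr : r \in GD by case/setIP: Rr.
split; rewrite ?(subsetP nGGD) ?(subsetP N_stable) ?(subsetP nGtGD) //.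
by rewrite (subsetP nNTM) // (subsetP sRM).
Qed.

Hypothesis max_ext_G : maximal_extensibility G Gt.
Hypothesis max_ext_N : maximal_extensibility N 'N_Gt(N)%g.
Variable Omega : Iirr Gt -> Iirr 'N_Gt(N)%g.
Hypothesis Omega_inj : {in Irr_over_p' p G Gt &, injective Omega}.
Hypothesis Omega_img : Omega @: Irr_over_p' p G Gt = Irr_over_p' p N 'N_Gt(N)%g.
Hypothesis Omega_equiv : {in 'N_GD(Q)%g & Irr_over_p' p G Gt, forall a i,
  Omega (conjg_Iirr i a) = conjg_Iirr (Omega i) a}.
Hypothesis Omega_center : forall nu : Iirr 'Z(Gt)%g,
  Omega @: (Irr_over_p' p G Gt :&: Irr_above Gt nu) =
    Irr_over_p' p N 'N_Gt(N)%g :&: Irr_above 'N_Gt(N)%g nu.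
Hypothesis Omega_mul : forall i (l : Iirr (Gt / G)%g), i \in Irr_over_p' p G Gt ->
  'chi_(Omega (cfIirr ('chi_i * ('chi_l %% G)%CF))) =
    'chi_(Omega i) * 'Res['N_Gt(N)%g] ('chi_l %% G)%CF.

Local Notation calG := (Irr_over_p' p G Gt).
Local Notation calN := (Irr_over_p' p N NT).
Local Notation IG := (Irr_p' p G).
Local Notation IN := (Irr_p' p N).

Lemma Omega_calN i : i \in calG -> Omega i \in calN.
Proof. by move=> Gi; rewrite -Omega_img imset_f. Qed.

Lemma calG_conj i r : i \in calG -> r \in R -> conjg_Iirr i r \in calG.
Proof.
move=> Gi Rr; have [nGr _ nGtr _] := mem_nR Rr.
have [i0 b0] := exists_below G i; have b0r := Irr_below_conjg nGr nGtr b0.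
by rewrite (Irr_over_below G_normal_Gt p b0r) conjg_Irr_p' -(Irr_over_below
  G_normal_Gt p b0).
Qed.

Lemma Omega_mul_lin i (mu : 'CF(Gt)) :
  i \in calG -> mu \is a linear_char -> G \subset cfker mu ->
  exists i', [/\ i' \in calG, 'chi_i' = 'chi_i * mu
    & 'chi_(Omega i') = 'chi_(Omega i) * 'Res[NT] mu].
Proof.
move=> Gi lin_mu ker_mu; have [i' Di'] := irrP (mul_lin_irr lin_mu (mem_irr i)).
rewrite mulrC in Di'; exists i'; split=> //.
  have [i0 b0] := exists_below G i; have b0' := b0.
  rewrite (Irr_over_below G_normal_Gt p (i0 := i0)).
    by rewrite -(Irr_over_below G_normal_Gt p b0).
  move: b0; rewrite !in_set -Di' rmorphM /=.
  by rewrite (cfRes_sub_ker ker_mu) lin_char1 // scale1r mulr1.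
have lin_q : (mu / G)%CF \is a linear_char by apply: cfQuo_lin_char.
have [l Dl] := irrP (lin_char_irr lin_q).
have Dmu : mu = ('chi_l %% G)%CF by rewrite -Dl cfQuoK.
by have := Omega_mul l Gi; rewrite -Dmu Di' irrK.
Qed.

(** From right to left, the linear character of NT / N extends to one of Gt / G,
because NT :&: G = N. *)
Lemma Omega_lin_orbit i i' :
  i \in calG -> i' \in calG ->
  (exists mu : 'CF(Gt), [/\ mu \is a linear_char, G \subset cfker mu
                           & 'chi_i' = 'chi_i * mu]) <->
  (exists mu : 'CF(NT), [/\ mu \is a linear_char, N \subset cfker mu
                           & 'chi_(Omega i') = 'chi_(Omega i) * mu]).
Proof.
move=> Gi Gi'; split=> -[mu [lin_mu ker_mu Dmu]].
  have [i1 [Gi1 Di1 Oi1]] := Omega_mul_lin Gi lin_mu ker_mu.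
  have -> : i' = i1 by apply: irr_inj; rewrite Dmu.
  exists ('Res[NT] mu); split; rewrite ?cfRes_lin_char //.
  rewrite cfker_Res ?subsetIl ?lin_charW // subsetI normal_sub ?nsNNT //.
  exact: subset_trans ker_mu.
have kerNT : NT :&: G \subset cfker mu by apply: subset_trans NTG_N ker_mu.
have [nu [lin_nu ker_nu Dnu]] :=
  lin_char_extension G_normal_Gt Gt_G_abelian (subsetIl _ _) lin_mu kerNT.
have [i1 [Gi1 Di1 Oi1]] := Omega_mul_lin Gi lin_nu ker_nu.
exists nu; split=> //; rewrite -Di1; congr 'chi_ _; apply: Omega_inj => //.
by apply: irr_inj; rewrite Dmu Oi1 Dnu.
Qed.

(** Both sides say that 'chi_i ^ r and 'chi_i' differ by a linear character, by
[clifford_orbit] for G in Gt and for N in NT. *)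
Lemma Omega_conj_orbit i i' i0 i0' j0 j0' r :
  i \in calG -> i' \in calG -> r \in R ->
  i0 \in Irr_below G 'chi_i -> i0' \in Irr_below G 'chi_i' ->
  j0 \in Irr_below N 'chi_(Omega i) -> j0' \in Irr_below N 'chi_(Omega i') ->
  (exists2 t, t \in Gt & conjg_Iirr (conjg_Iirr i0 r) t = i0') <->
  (exists2 t, t \in NT & conjg_Iirr (conjg_Iirr j0 r) t = j0').
Proof.
move=> Gi Gi' Rr bi bi' bj bj'; have [nGr nNr nGtr nNTr] := mem_nR Rr.
have bir := Irr_below_conjg nGr nGtr bi; have bjr := Irr_below_conjg nNr nNTr bj.
rewrite -Omega_equiv // in bjr.
have H1 := clifford_orbit G_normal_Gt Gt_G_abelian (max_ext_G i0') bir bi'.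
have H2 := clifford_orbit nsNNT NT_N_abelian (max_ext_N j0') bjr bj'.
have H3 := Omega_lin_orbit (calG_conj Gi Rr) Gi'.
by split=> [/H1/H3/H2|/H2/H3/H1].
Qed.

Section GoodPair.

Variables (i : Iirr Gt) (i0 : Iirr G) (j0 : Iirr N).
Hypotheses (Gi : i \in calG) (bi0 : i0 \in Irr_below G 'chi_i).
Hypothesis bj0 : j0 \in Irr_below N 'chi_(Omega i).

(** Both sides contain G, so they are determined by the linear characters of
Gt / G that are trivial on them.  These are the ones that fix 'chi_i, for the
left hand side, and the ones whose restriction fixes 'chi_(Omega i), for the
right hand side. *)
Lemma Omega_inertia_Gt : 'I_Gt['chi_i0] = (G * 'I_NT['chi_j0])%g.
Proof.
have nGI : 'I_NT['chi_j0] \subset 'N(G)%g.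
  by rewrite (subset_trans (subsetIl _ _)) // (subset_trans (subsetIl _ _)) ?normal_norm.
have sIGt : 'I_NT['chi_j0] \subset Gt.
  by rewrite (subset_trans (subsetIl _ _)) ?subsetIl.
rewrite -norm_joinEr //.
have ci : i \in irr_constt ('Ind[Gt] 'chi_i0) by rewrite -Irr_belowE.
have cj : Omega i \in irr_constt ('Ind[NT] 'chi_j0) by rewrite -Irr_belowE.
have key (mu : 'CF(Gt)) : mu \is a linear_char -> G \subset cfker mu ->
    ('I_Gt['chi_i0] \subset cfker mu) <-> ('I_NT['chi_j0] \subset cfker mu).
  move=> lin_mu ker_mu; have [i' [Gi' Di' Oi']] := Omega_mul_lin Gi lin_mu ker_mu.
  have lin_R : 'Res[NT] mu \is a linear_char by apply: cfRes_lin_char.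
  have kerR : cfker ('Res[NT] mu) = NT :&: cfker mu.
    by rewrite cfker_Res ?subsetIl ?lin_charW.
  split=> kerI.
    have e : 'chi_i * mu = 'chi_i.
      exact: (constt_Ind_mul_lin_fix G_normal_Gt Gt_G_abelian (max_ext_G i0) lin_mu
        kerI ci).
    rewrite e in Di'; rewrite (irr_inj Di') in Oi'.
    have ker_mu' : N \subset cfker ('Res[NT] mu).
      rewrite kerR subsetI normal_sub ?nsNNT //; exact: subset_trans ker_mu.
    have := constt_Ind_mul_lin nsNNT NT_N_abelian (max_ext_N j0) lin_R ker_mu'
      (esym Oi') cj.
    by rewrite kerR subsetI => /andP[].
  have kerI' : 'I_NT['chi_j0] \subset cfker ('Res[NT] mu).
    by rewrite kerR subsetI subsetIl.
  have e := constt_Ind_mul_lin_fix nsNNT NT_N_abelian (max_ext_N j0) lin_R kerI' cj.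
  rewrite e in Oi'; have ei : i' = i by apply: Omega_inj => //; apply: irr_inj.
  rewrite ei in Di'.
  exact: (constt_Ind_mul_lin G_normal_Gt Gt_G_abelian (max_ext_G i0) lin_mu ker_mu
    (esym Di') ci).
have sGJ : G <*> 'I_NT['chi_j0] \subset Gt by rewrite join_subG sGGt.
apply/eqP; rewrite eqEsubset; apply/andP; split.
  apply: (subset_lin_char_annihilator (I := (G <*> 'I_NT['chi_j0])%G)
    (J := 'I_Gt['chi_i0]%G) G_normal_Gt Gt_G_abelian (joing_subl _ _) sGJ (subsetIl _ _)).
  move=> mu lin_mu ker_mu; rewrite join_subG => /andP[_ kerI].
  exact/(key mu lin_mu ker_mu).
apply: (subset_lin_char_annihilator (J := (G <*> 'I_NT['chi_j0])%G)
  (I := 'I_Gt['chi_i0]%G) G_normal_Gt Gt_G_abelian (sub_Inertia _ sGGt) (subsetIl _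
    _) sGJ).
move=> mu lin_mu ker_mu kerI; rewrite join_subG ker_mu.
exact/(key mu lin_mu ker_mu).
Qed.

Hypothesis good_i0 : ('I_Gt['chi_i0] ><| 'I_D['chi_i0])%g = 'I_GD['chi_i0].
Hypothesis good_j0 : let O := ('I_M['chi_j0] * G)%g in
  ((Gt :&: O) ><| (D :&: O))%g = O.

Let tiGtD : Gt :&: D = 1%g. Proof. by case/sdprod_context: GD_sdprod. Qed.
Let sDGD : D \subset GD. Proof. by case/sdprod_context: GD_sdprod. Qed.

Let eq_complement u d b v : u \in Gt -> v \in Gt -> d \in D -> b \in D ->
  d = (u * b * v)%g -> d = b.
Proof.
move=> Gu Gv Dd Db e; apply/eqP; rewrite eq_mulgV1; apply/eqP/set1gP; rewrite -tiGtD inE.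
rewrite (groupM Dd) ?groupV // andbT.
have -> : (d * b^-1 = u * v ^ b^-1)%g by rewrite e conjgE invgK !mulgA.
rewrite groupM // memJ_norm // groupV.
by rewrite (subsetP nGtGD) // (subsetP sDGD).
Qed.

Let sIM_N : 'I_M['chi_j0] \subset 'N(G)%g.
Proof. by rewrite (subset_trans (subsetIl _ _)) // (subset_trans (subsetIl _ _)). Qed.

Let orbit_i0 r : r \in R ->
  (exists2 t, t \in Gt & conjg_Iirr (conjg_Iirr i0 r) t = i0) <->
  (exists2 t, t \in NT & conjg_Iirr (conjg_Iirr j0 r) t = j0).
Proof. by move=> Rr; apply: (Omega_conj_orbit (i := i) (i' := i)). Qed.

(** Both sides are semidirect products with the same intersection with Gt.  Their
intersections with D also agree, for they are determined by the stabilisers of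
the orbit of 'chi_i0 under Gt and of that of 'chi_j0 under NT, which correspond
to each other by [Omega_conj_orbit]. *)
Lemma good_inertia_GD : 'I_GD['chi_i0] = ('I_M['chi_j0] * G)%g.
Proof.
have TO : Gt :&: ('I_M['chi_j0] * G)%g = 'I_Gt['chi_i0].
  have sINT : 'I_NT['chi_j0] \subset 'I_M['chi_j0] by rewrite setSI ?sNTM.
  rewrite -group_modr // Omega_inertia_Gt !setIA (setIidPl sGtGD).
  exact: normC (subset_trans sINT sIM_N).
have := good_j0; rewrite /= -(norm_joinEl sIM_N) => /sdprodW /=.
rewrite (norm_joinEl sIM_N) TO => defO; rewrite -defO -(sdprodW good_i0).
congr (_ * _)%g; apply/setP=> d; apply/idP/idP.
  move=> Id; have /setIP[Dd Id0] := Id; rewrite inE Dd /= -defO.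
  have GDd := subsetP sDGD d Dd; have := GDd; rewrite -mulGR => /mulsgP[g y Gg Ry Dy].
  have [nGy nNy nGty nNTy] := mem_nR Ry.
  have Iy : y \in 'I['chi_i0].
    rewrite -[y](mulKg g) -Dy groupM ?groupV //.
    exact: subsetP (sub_inertia _) g Gg.
  have [|t NTt] := proj1 (orbit_i0 Ry).
    exists 1%g => //; rewrite conjg_Iirr1; apply/eqP.
    by rewrite -mem_inertia_Iirr.
  have [Gtt nNt] := setIP NTt.
  rewrite -conjg_IirrM // => /eqP; rewrite -mem_inertia_Iirr ?(groupM nNy nNt) // => Jyt.
  have My : y \in M := subsetP sRM y Ry.
  have IMyt : (y * t)%g \in 'I_M['chi_j0].
    by rewrite inE Jyt andbT groupM // (subsetP sNTM).
  have : (y * t)%g \in ('I_M['chi_j0] * G)%g by rewrite -[(y * t)%g]mulg1 mem_mulg.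
  rewrite -{1}defO => /mulsgP[a b /setIP[Gta _] /setIP[Db Ob] Dyt].
  suff -> : d = b by rewrite defO.
  apply: (@eq_complement (g * a)%g d b t^-1%g) => //; rewrite ?groupM ?groupV //.
    exact: subsetP sGGt g Gg.
  by rewrite -mulgA Dy -!mulgA; congr (_ * _)%g; rewrite mulgA -Dyt mulgK.
case/setIP=> Dd /mulsgP[m g /setIP[Mm Jm] Gg Dm].
have GDd := subsetP sDGD d Dd.
have := Mm; rewrite -{1}mulNR => /mulsgP[n y Nn Ry Dmy].
have [nGy nNy nGty nNTy] := mem_nR Ry.
have Jy : y \in 'I['chi_j0].
  rewrite -[y](mulKg n) -Dmy groupM ?groupV //.
  exact: subsetP (sub_inertia _) n Nn.
have [|t Gtt] := proj2 (orbit_i0 Ry).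
  exists 1%g => //; rewrite conjg_Iirr1; apply/eqP.
  by rewrite -mem_inertia_Iirr.
have GDt := subsetP sGtGD t Gtt; have nGt := subsetP nGGD t GDt.
rewrite -conjg_IirrM // => /eqP; rewrite -mem_inertia_Iirr ?(groupM nGy nGt) // => Iyt.
have GDy : y \in GD by case/setIP: Ry.
have : (y * t)%g \in 'I_GD['chi_i0] by rewrite inE Iyt andbT groupM.
rewrite -(sdprodW good_i0) => /mulsgP[a b /setIP[Gta _] Ib Dyt].
suff -> : d = b by [].
have [Db _] := setIP Ib.
apply: (@eq_complement (n * a)%g d b (t^-1 * g)%g) => //; rewrite ?groupM ?groupV //.
- exact: subsetP sGGt n (subsetP sNG n Nn).
- exact: subsetP sGGt g Gg.
by rewrite Dm Dmy -!mulgA; congr (_ * _)%g; rewrite !mulgA -Dyt mulgK.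
Qed.

Lemma good_inertia_M : M :&: 'I_GD['chi_i0] = 'I_M['chi_j0].
Proof.
rewrite good_inertia_GD; apply/eqP; rewrite eqEsubset; apply/andP; split.
  apply/subsetP=> x /setIP[Mx /mulsgP[m g IMm Gg Dx]].
  have [Mm _] := setIP IMm.
  have Ng : g \in N.
    apply: (subsetP nNG); rewrite inE Gg /= -[g](mulKg m) -Dx.
    by have := groupM (groupVr Mm) Mx; case/setIP.
  rewrite Dx groupM // inE (subsetP (normal_sub nsNM)) //.
  exact: subsetP (sub_inertia _) g Ng.
by rewrite subsetI subsetIl mulG_subl.
Qed.

Lemma good_stab r : r \in R -> conjg_Iirr i0 r = i0 <-> conjg_Iirr j0 r = j0.
Proof.
move=> Rr; have [nGr nNr _ _] := mem_nR Rr; have Mr := subsetP sRM r Rr.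
have GDr : r \in GD by case/setIP: Mr.
have : (r \in M :&: 'I_GD['chi_i0]) = (r \in 'I_M['chi_j0]).
  by rewrite good_inertia_M.
rewrite in_setI Mr /= [in LHS]in_setI GDr [in RHS]in_setI Mr /=.
by rewrite !mem_inertia_Iirr // => e; split=> /eqP; [rewrite e | rewrite -e] => /eqP.
Qed.

Hypothesis ext_i0 : extends_to 'I_(G <*> D)['chi_i0] 'chi_i0.
Hypothesis ext_j0 : extends_to 'I_('N_(G <*> D)(N))['chi_j0] 'chi_j0.

(** The characters 'chi_k and 'chi_l are the extensions of 'chi_i0 and 'chi_j0 that
induce to 'chi_i and 'chi_(Omega i).  Writing 'chi_i ^ h as 'chi_i * mu, the
properties of Omega give the same relation for 'chi_(Omega i), and
[ext_conj_twist] turns both into the twists of 'chi_k and 'chi_l by mu. *)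
Lemma good_linked : linked_proj_reprs 'I_GD['chi_i0]%G 'chi_i0 'chi_j0.
Proof.
pose A := 'I_GD['chi_i0]%G; pose T := 'I_Gt['chi_i0]%G.
pose H := 'I_(G <*> D)['chi_i0]%G; pose MJ := 'I_M['chi_j0]%G.
pose NJ := 'I_NT['chi_j0]%G; pose HJ := 'I_('N_(G <*> D)(N))['chi_j0]%G.
have sGDGD : G <*> D \subset GD by rewrite join_subG sGGD.
have sHJMJ : HJ \subset MJ by rewrite setSI // setSI.
have MA : M :&: A = MJ := good_inertia_M.
have sMJA : MJ \subset A by rewrite -MA subsetIr.
have ci : i \in irr_constt ('Ind[Gt] 'chi_i0) by rewrite -Irr_belowE.
have cj : Omega i \in irr_constt ('Ind[NT] 'chi_j0) by rewrite -Irr_belowE.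
have [k Rk Dk] := constt_Ind_ext_Ind G_normal_Gt Gt_G_abelian (max_ext_G i0) ci.
have [l Rl Dl] := constt_Ind_ext_Ind nsNNT NT_N_abelian (max_ext_N j0) cj.
have [k2 Rk2] := ext_i0; have [l2 Rl2] := ext_j0.
have sTGt : T \subset Gt by apply: subsetIl.
have sNJNT : NJ \subset NT by apply: subsetIl.
have nGtM : M \subset 'N(Gt)%g by rewrite (subset_trans (subsetIl _ _)).
have nsTA : T <| A.
  rewrite /normal setSI //=; apply: normsI; last by rewrite normsG ?subsetIr.
  by rewrite (subset_trans (subsetIl _ _)).
have sNTT : NJ \subset T by rewrite /= Omega_inertia_Gt mulG_subr.
have nNJMJ : MJ \subset 'N(NJ)%g.
  apply: normsI; last by rewrite normsG ?subsetIr.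
  by rewrite (subset_trans (subsetIl _ _)) ?nNTM.
have defM : (NJ * HJ)%g = MJ.
  apply/eqP; rewrite eqEsubset mul_subG ?sHJMJ ?setSI ?sNTM //=.
  apply/subsetP=> m MJm; have Am := subsetP sMJA m MJm.
  move: Am; rewrite /= -(sdprodW good_i0) => /mulsgP[t d Tt /setIP[Dd _] Dm].
  have nGNJ : NJ \subset 'N(G)%g.
    by rewrite (subset_trans sNJNT) // (subset_trans (subsetIl _ _)) ?normal_norm.
  have Tt' := Tt; rewrite Omega_inertia_Gt -(normC nGNJ) in Tt'.
  case/mulsgP: Tt' => n g NJn Gg Dt.
  rewrite Dm Dt -mulgA mem_mulg //.
  have MJgd : (g * d)%g \in MJ.
    rewrite -[(g * d)%g](mulKg n) groupM ?groupV //.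
      by apply: subsetP NJn; rewrite setSI ?sNTM.
    by rewrite mulgA -Dt -Dm.
  have [Mgd Jgd] := setIP MJgd; have [_ nNgd] := setIP Mgd.
  rewrite inE Jgd andbT inE nNgd andbT groupM //.
    exact: subsetP (joing_subl G D) g Gg.
  exact: subsetP (joing_subr G D) d Dd.
have sGGD' : G \subset G <*> D by apply: joing_subl.
have sNGD' : N \subset 'N_(G <*> D)(N)%g.
  by rewrite subsetI normG (subset_trans sNG).
have nsGA : G <| A by apply: normal_Inertia.
have sGT : G \subset T by apply: sub_Inertia.
have sGH : G \subset H by apply: sub_Inertia.
have sHJA : HJ \subset A := subset_trans sHJMJ sMJA.
have sHJH : HJ \subset H.
  rewrite subsetI (subset_trans (subsetIl _ _)) ?subsetIl //=.
  by rewrite (subset_trans sHJA) ?subsetIr.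
have sNHJ : N \subset HJ by apply: sub_Inertia.
have nsNNJ : N <| NJ by apply: normal_Inertia (normal_sub nsNNT).
have nNJHJ : HJ \subset 'N(NJ)%g := subset_trans sHJMJ nNJMJ.
have nNHJ : HJ \subset 'N(N)%g.
  by rewrite (subset_trans (subsetIl _ _)) ?subsetIr.
have defT : (G * NJ)%g = T by rewrite /= Omega_inertia_Gt.
have defA : (T * HJ)%g = A.
  by rewrite -defT -mulgA defM /= -(normC sIM_N) -good_inertia_GD.
have tiTHJ : T :&: HJ \subset N.
  have tiGt : Gt :&: (G <*> D)%G \subset G.
    rewrite /= norm_joinEr ?(subset_trans sDGD) // setIC -group_modl //.
    by rewrite setIC tiGtD mulg1.
  apply: subset_trans nNG; rewrite subsetI (subset_trans (subsetIr _ _) nNHJ) andbT.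
  apply: subset_trans tiGt; apply: setISS => //.
  by rewrite (subset_trans (subsetIl _ _)) ?subsetIl.
have defMA : (NJ * HJ)%g = 'N_A(N)%g.
  by rewrite defM -MA setIAC (setIidPr (Inertia_sub _ _)) setIC.
apply: (@linked_of_extensions _ G N A T H NJ HJ 'chi_i0 'chi_j0 'chi_k 'chi_k2
  'chi_l 'chi_l2);
  rewrite ?irr_char ?mem_irr //.
  move=> h HJh; have /setIP[Mh Jh] := subsetP sHJMJ h HJh.
  have Ih : h \in 'I['chi_i0] by have /setIP[_] := subsetP sHJA h HJh.
  have [nGth nNTh] := (subsetP nGtM h Mh, subsetP nNTM h Mh).
  have nGh := subsetP (norm_inertia _) h Ih.
  have [r Rr [eG _ eGt eNT]] := conj_R_M Mh.
  have [nGr _ nGtr _] := mem_nR Rr.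
  have i0r : conjg_Iirr i0 r = i0 by apply/eqP; rewrite -eG -mem_inertia_Iirr.
  have := Irr_below_conjg nGr nGtr bi0; rewrite i0r Irr_belowE => cir.
  have [mu [lin_mu ker_mu Dmu]] :=
    constt_Ind_lin_orbit G_normal_Gt Gt_G_abelian (max_ext_G i0) ci cir.
  have [i' [Gi' Di' Oi']] := Omega_mul_lin Gi lin_mu ker_mu.
  have ei' : i' = conjg_Iirr i r by apply: irr_inj; rewrite Dmu.
  have kerR (L : {group gT}) : L \subset Gt -> G :&: L \subset cfker ('Res[L] mu).
    move=> sLGt; rewrite cfker_Res ?lin_charW // subsetI subsetIr.
    by rewrite (subset_trans (subsetIl _ _)).
  exists ('Res[T] mu); split; first exact: cfRes_lin_char.
  - by have := kerR T sTGt; rewrite (setIidPl sGT).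
  - apply: (ext_conj_twist G_normal_Gt) => //.
    by rewrite -Dk -conjg_IirrE eGt.
  rewrite (cfResRes _ sNTT sTGt) -(cfResRes _ sNJNT (subsetIl _ _)).
  apply: (ext_conj_twist nsNNT) => //.
  - exact: cfRes_lin_char.
  - have := kerR NT (subsetIl _ _); apply: subset_trans.
    by rewrite subsetI sNG normal_sub ?nsNNT.
  by rewrite -Dl -conjg_IirrE eNT -Omega_equiv // -ei'.
move=> z /setIP[Az cGz].
have Zz : z \in 'Z(Gt)%g by rewrite -cent_G inE cGz andbT; case/setIP: Az.
have [Gtz cGtz] := setIP Zz; have NTz := subsetP sZNT z Zz.
have cNTz : z \in 'C(NT)%g by apply: (subsetP (centS _)) cGtz; apply: subsetIl.
split; first by rewrite inE NTz (subsetP (cent_sub_inertia _)) // (subsetP (centS sNG)).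
rewrite -(cfInd_center_ratio _ sTGt cGtz) -(cfInd_center_ratio _ sNJNT cNTz) -Dk -Dl.
have [nu bnu] := exists_below 'Z(Gt)%G i.
have inu : i \in Irr_above Gt nu by rewrite in_set -Irr_belowE.
have : Omega i \in Omega @: (calG :&: Irr_above Gt nu).
  by rewrite imset_f // inE Gi.
rewrite Omega_center => /setIP[_ Oinu].
rewrite (irr_center_ratio (center_sub Gt) _ inu Zz); last by rewrite centsC subsetIr.
by rewrite (irr_center_ratio sZNT cZNT Oinu Zz).
Qed.

End GoodPair.

Definition good_pair (i0 : Iirr G) (j0 : Iirr N) : Prop :=
  exists i, [/\ i \in calG, i0 \in Irr_below G 'chi_i,
    j0 \in Irr_below N 'chi_(Omega i),
    ('I_Gt['chi_i0] ><| 'I_D['chi_i0])%g = 'I_GD['chi_i0] /\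
      extends_to 'I_(G <*> D)['chi_i0] 'chi_i0
  & (let O := ('I_M['chi_j0] * G)%g in ((Gt :&: O) ><| (D :&: O))%g = O) /\
      extends_to 'I_('N_(G <*> D)(N))['chi_j0] 'chi_j0].

Definition matched (i : Iirr G) (j : Iirr N) : Prop :=
  exists i0 j0 r, [/\ good_pair i0 j0, r \in R,
    i = conjg_Iirr i0 r & j = conjg_Iirr j0 r].

Lemma conj_RMG (i : Iirr G) : {in R &, forall x y,
  conjg_Iirr i (x * y)%g = conjg_Iirr (conjg_Iirr i x) y}.
Proof.
by move=> x y /mem_nR[nGx _ _ _] /mem_nR[nGy _ _ _]; apply: conjg_IirrM.
Qed.

Lemma conj_RMN (j : Iirr N) : {in R &, forall x y,
  conjg_Iirr j (x * y)%g = conjg_Iirr (conjg_Iirr j x) y}.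
Proof.
by move=> x y /mem_nR[_ nNx _ _] /mem_nR[_ nNy _ _]; apply: conjg_IirrM.
Qed.

Lemma matched_conj i j : matched i j ->
  {in R, forall x, matched (conjg_Iirr i x) (conjg_Iirr j x)}.
Proof.
move=> [i0 [j0 [r [B Rr -> ->]]]] x Rx; exists i0, j0, (r * x)%g.
by rewrite groupM ?conj_RMG ?conj_RMN.
Qed.

Lemma matched_stab i j : matched i j ->
  {in R, forall x, conjg_Iirr i x = i <-> conjg_Iirr j x = j}.
Proof.
move=> [i0 [j0 [r [[i' [Gi' bi bj [gi _] [gj _]]] Rr -> ->]]]] x Rx.
have Rc : (r * x * r^-1)%g \in R by rewrite !groupM ?groupV.
have [st1 st2] := good_stab Gi' bi bj gi gj Rc.
have RV : (r^-1)%g \in R by rewrite groupV.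
have eG (k : Iirr G) : conjg_Iirr k (r * x * r^-1)%g = k <->
    conjg_Iirr (conjg_Iirr k r) x = conjg_Iirr k r.
  rewrite !conj_RMG ?groupM //; split=> [{2}<- | ->]; last by rewrite conjg_IirrK.
  by rewrite conjg_IirrKV.
have eN (k : Iirr N) : conjg_Iirr k (r * x * r^-1)%g = k <->
    conjg_Iirr (conjg_Iirr k r) x = conjg_Iirr k r.
  rewrite !conj_RMN ?groupM //; split=> [{2}<- | ->]; last by rewrite conjg_IirrK.
  by rewrite conjg_IirrKV.
by split=> [/eG/st1/eN | /eN/st2/eG].
Qed.

Lemma below_R_conjG i i0 i1 : i0 \in Irr_below G 'chi[Gt]_i ->
  i1 \in Irr_below G 'chi_i ->
  exists2 r, r \in R & conjg_Iirr i0 r = i1.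
Proof.
move=> b0 b1; have [t Gtt <-] := Irr_below_conj G_normal_Gt b0 b1.
by have [r Rr e] := conj_R_Gt Gtt; exists r.
Qed.

Lemma below_R_conjN l j0 j1 : j0 \in Irr_below N 'chi[NT]_l ->
  j1 \in Irr_below N 'chi_l -> exists2 r, r \in R & conjg_Iirr j0 r = j1.
Proof.
move=> b0 b1; have [t NTt <-] := Irr_below_conj nsNNT b0 b1.
by have [r Rr [_ e _ _]] := conj_R_M (subsetP sNTM t NTt); exists r.
Qed.

Lemma good_orbit i0 j0 i0' j0' : good_pair i0 j0 -> good_pair i0' j0' ->
  (exists2 x, x \in R & conjg_Iirr i0 x = i0') <->
  (exists2 x, x \in R & conjg_Iirr j0 x = j0').
Proof.
move=> [i [Gi bi bj _ _]] [i' [Gi' bi' bj' _ _]]; split=> -[x Rx e].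
  have [toN _] := Omega_conj_orbit Gi Gi' Rx bi bi' bj bj'; have [|t NTt et] := toN.
    by exists 1%g; rewrite ?conjg_Iirr1.
  have [r Rr [_ er _ _]] := conj_R_M (subsetP sNTM t NTt).
  by exists (x * r)%g; rewrite ?groupM // conj_RMN // -er.
have [_ toG] := Omega_conj_orbit Gi Gi' Rx bi bi' bj bj'; have [|t Gtt et] := toG.
  by exists 1%g; rewrite ?conjg_Iirr1.
have [r Rr er] := conj_R_Gt Gtt.
by exists (x * r)%g; rewrite ?groupM // conj_RMG // -er.
Qed.

Lemma matched_orbit i j i' j' : matched i j -> matched i' j' ->
  (exists2 x, x \in R & conjg_Iirr i x = i') <->
  (exists2 x, x \in R & conjg_Iirr j x = j').
Proof.
move=> [i0 [j0 [r [B Rr -> ->]]]] [i0' [j0' [r' [B' Rr' -> ->]]]].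
have [orbG orbN] := good_orbit B B'.
split=> -[x Rx e].
  have [|y Ry ey] := orbG.
    exists (r * x * r'^-1)%g; first by rewrite !groupM ?groupV.
    by rewrite !conj_RMG ?groupM ?groupV // e conjg_IirrK.
  exists (r^-1 * y * r')%g; first by rewrite !groupM ?groupV.
  by rewrite !conj_RMN ?groupM ?groupV // conjg_IirrK ey.
have [|y Ry ey] := orbN.
  exists (r * x * r'^-1)%g; first by rewrite !groupM ?groupV.
  by rewrite !conj_RMN ?groupM ?groupV // e conjg_IirrK.
exists (r^-1 * y * r')%g; first by rewrite !groupM ?groupV.
by rewrite !conj_RMG ?groupM ?groupV // conjg_IirrK ey.
Qed.

Lemma matched_p' i j : matched i j -> (i \in IG) /\ (j \in IN).
Proof.
move=> [i0 [j0 [r [[i' [Gi' bi bj _ _]] Rr -> ->]]]]; rewrite !conjg_Irr_p'.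
rewrite -(Irr_over_below G_normal_Gt p bi) Gi'; split=> //.
by rewrite -(Irr_over_below nsNNT p bj) Omega_calN.
Qed.

Hypothesis stab_G : {in Irr_over_p' p G Gt, forall i,
  exists i0 : Iirr G,
    [/\ i0 \in Irr_below G 'chi_i, i0 \in Irr_p' p G,
        ('I_Gt['chi_i0] ><| 'I_D['chi_i0])%g = 'I_GD['chi_i0]
      & extends_to 'I_(G <*> D)['chi_i0] 'chi_i0]}.
Hypothesis stab_N : {in Irr_over_p' p N 'N_Gt(N)%g, forall i,
  exists i0 : Iirr N,
    let O := ('I_('N_GD(N))['chi_i0] * G)%g in
    [/\ i0 \in Irr_below N 'chi_i,
        ((Gt :&: O) ><| (D :&: O))%g = O
      & extends_to 'I_('N_(G <*> D)(N))['chi_i0] 'chi_i0]}.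

Lemma good_pair_below i : i \in calG -> exists i0 j0,
  [/\ good_pair i0 j0, i0 \in Irr_below G 'chi_i & j0 \in Irr_below N 'chi_(Omega i)].
Proof.
move=> Gi; have [i0 [bi _ gi ei]] := stab_G Gi.
have [j0 [bj gj ej]] := stab_N (Omega_calN Gi).
by exists i0, j0; split=> //; exists i.
Qed.

Lemma matched_left : {in IG, forall i, exists j, matched i j}.
Proof.
move=> i p'i; have [i' bi] := exists_above G_normal_Gt i.
have Gi' : i' \in calG by rewrite (Irr_over_below G_normal_Gt p bi).
have [i0 [j0 [B bi0 _]]] := good_pair_below Gi'.
have [r Rr Dr] := below_R_conjG bi0 bi.
by exists (conjg_Iirr j0 r), i0, j0, r.
Qed.

Lemma matched_right : {in IN, forall j, exists i, matched i j}.
Proof.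
move=> j p'j; have [l bj] := exists_above nsNNT j.
have : l \in calN by rewrite (Irr_over_below nsNNT p bj).
rewrite -Omega_img => /imsetP[i Gi Dl]; rewrite {l}Dl in bj.
have [i0 [j0 [B _ bj0]]] := good_pair_below Gi.
have [r Rr Dr] := below_R_conjN bj0 bj.
by exists (conjg_Iirr i0 r), i0, j0, r.
Qed.

Variables (sT : finGroupType) (S : {group sT}) (pi : {morphism G >-> sT}).
Hypothesis G_cover : maximal_perfect_central_extension S pi.
Hypothesis GD_Aut : (conj_aut G @* GD)%g = Aut G.

(** The linking of a good pair is transported to its conjugates, and conjugation
by GD provides all automorphisms of G. *)
Lemma matched_cohom i j : matched i j -> cohom 'chi_i 'chi_j.
Proof.
move=> Bij; pose A := 'I_GD['chi_i]%G.
have nsGA : G <| A by apply: normal_Inertia.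
have autE y x : y \in GD -> x \in G -> conj_aut G y x = (x ^ y)%g.
  by move=> GDy Gx; rewrite norm_conj_autE ?(subsetP nGGD).
have inertiaP (L : {group gT}) (k : Iirr L) y : y \in 'N(L)%g ->
    reflect {in L, forall x, 'chi_k (x ^ y)%g = 'chi_k x} (y \in 'I['chi_k]).
  move=> nLy; apply: (iffP idP) => [Iy x _ | Iy]; first exact: inertia_valJ.
  rewrite inE nLy; apply/eqP/cfun_inP=> x Lx; rewrite cfConjgE //.
  by rewrite -Iy ?memJ_norm ?groupV // conjgKV.
have autP y : y \in GD ->
    (conj_aut G y \in Aut G) /\
    ({in N, forall x, conj_aut G y x \in N} <-> y \in M).
  move=> GDy; split; first by rewrite -GD_Aut mem_morphim ?(subsetP nGGD).
  rewrite inE GDy /=; split=> [H | nNy x Nx].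
    by rewrite inE; apply/subsetP=> _ /imsetP[x Nx ->]; rewrite -autE ?H ?(subsetP sNG).
  by rewrite autE ?(subsetP sNG) // memJ_norm.
have stabM y : y \in M -> (y \in 'I['chi_i]) = (y \in 'I['chi_j]).
  move=> My; have [r Rr [eG eN _ _]] := conj_R_M My.
  have nNy : y \in 'N(N)%g by case/setIP: My.
  have nGy : y \in 'N(G)%g by case/setIP: My => /(subsetP nGGD).
  rewrite !mem_inertia_Iirr // eG eN.
  have [st1 st2] := matched_stab Bij Rr.
  by apply/eqP/eqP.
apply: (cohom_of_linked (A := A) G_cover nsGA sNG nNG sZN); rewrite ?mem_irr //.
- apply/eqP; rewrite eqEsubset mul_subG ?subsetIl ?(normal_sub nsGA) //=.
  apply/subsetP=> a Aa; have /setIP[GDa _] := Aa.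
  have := GDa; rewrite -{1}mulGR => /mulsgP[g r Gg Rr Da]; rewrite Da mem_mulg //.
  have [_ nNr _ _] := mem_nR Rr; rewrite inE nNr andbT.
  by rewrite -(mulKg g r) -Da groupM ?groupV // (subsetP (normal_sub nsGA)).
- apply/setP=> a; apply/morphimP/Aut_stab_charP =>
  [[y nGy /setIP[GDy Iy] ->] | [Aut_a aG chi_a]].
    split; first by have [] := autP y GDy.
      by move=> x Gx; rewrite autE // memJ_norm.
    by move=> x Gx; rewrite autE // inertia_valJ.
  have: a \in conj_aut G @* GD by rewrite GD_Aut.
  case/morphimP=> y nGy GDy Da; exists y => //; rewrite inE GDy /=.
  by apply/inertiaP => // x Gx; rewrite -autE // -Da chi_a.
- apply/setP=> a; apply/Aut_stab_charP/Aut_stab_charP => -[Aut_a aN chi_a];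
    split=> // x Xx.
    have: a \in conj_aut G @* GD by rewrite GD_Aut.
    case/morphimP=> y nGy GDy Da; have [_ [toM _]] := autP y GDy.
    have My : y \in M by apply: toM; rewrite -Da.
    rewrite Da autE ?(subsetP sNG) //; apply: inertia_valJ.
    rewrite -stabM //; apply/inertiaP => // z Gz.
    by rewrite -autE // -Da chi_a.
  have: a \in conj_aut G @* GD by rewrite GD_Aut.
  case/morphimP=> y nGy GDy Da; have [_ [toM _]] := autP y GDy.
  have My : y \in M by apply: toM; rewrite -Da.
  rewrite Da autE //; apply: inertia_valJ.
  rewrite stabM //; apply/inertiaP => [|z Nz]; first by case/setIP: My.
  by rewrite -autE ?(subsetP sNG) // -Da chi_a.
have [i0 [j0 [r [[i' [Gi' bi bj [gi ei] [gj ej]]] Rr Di Dj]]]] := Bij.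
have [nGr nNr _ _] := mem_nR Rr.
have := linked_proj_reprs_conj nGr nNr (good_linked Gi' bi bj gi gj ei ej).
rewrite -!conjg_IirrE -Di -Dj; congr (linked_proj_reprs _ _ _).
apply: val_inj; rewrite /= conjIg Di conjg_IirrE -conjg_inertia //.
by rewrite (normP _) // (subsetP (normG GD)) //; case/setIP: Rr.
Qed.

Lemma inductive_McKay_criterion : N \proper G -> inductive_McKay p G Q.
Proof.
move=> N_proper.
have lift_aut a : a \in Aut_stab G Q -> exists2 r, r \in R & a = conj_aut G r.
  case/Aut_stabP; rewrite -GD_Aut => /morphimP[y nGy GDy ->] aQ; exists y => //.
  rewrite inE GDy inE; apply/subsetP=> _ /imsetP[x Qx ->].
  by rewrite -(norm_conj_autE nGy) ?aQ // (subsetP (pHall_sub Q_sylow)).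
have [om [om_inj om_img om_equiv omB]] :=
  @equivariant_bijection gT R (Iirr G) (Iirr N) (@conjg_Iirr _ _) (@conjg_Iirr _ _)
    IG IN matched 0 (@conjg_Iirr1 _ G) conj_RMG (@conjg_Iirr1 _ N) conj_RMN
    (fun x i _ p'i => etrans (conjg_Irr_p' p i x) p'i)
    (fun i j B => proj2 (matched_p' B)) matched_conj matched_stab
    matched_left (fun j p'j => let: ex_intro i B := matched_right p'j in
                   ex_intro2 _ _ i (proj1 (matched_p' B)) B) matched_orbit.
exists N; split=> //.
  apply/subsetP=> a Qa; have [r Rr Da] := lift_aut a Qa.
  have [Aut_a _] := Aut_stabP _ _ _ Qa.
  apply/Aut_stabP; split=> // x Nx; have [nGr nNr _ _] := mem_nR Rr.
  by rewrite Da norm_conj_autE ?(subsetP sNG) // memJ_norm.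
exists om; split=> //.
- move=> a Qa i j p'i p'j chi_ij; have [r Rr Da] := lift_aut a Qa.
  have [nGr nNr _ _] := mem_nR Rr.
  have -> : j = conjg_Iirr i r.
    apply: irr_inj; rewrite conjg_IirrE; apply/cfun_inP=> x Gx.
    rewrite cfConjgE // -chi_ij ?memJ_norm ?groupV //.
    by rewrite Da norm_conj_autE ?memJ_norm ?groupV // conjgKV.
  move=> x Nx; rewrite om_equiv // conjg_IirrE Da norm_conj_autE ?(subsetP sNG) //.
  by rewrite cfConjgEJ.
- move=> nu; rewrite -om_img; apply/setP=> j.
  have above i : i \in IG -> (i \in Irr_above G nu) = (om i \in Irr_above N nu).
    move=> p'i; have [e _ _] := matched_cohom (omB i p'i).
    by rewrite !in_set !constt_Ind_Res; move/setP: e => /(_ nu); rewrite !in_set.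
  apply/imsetP/setIP=> [[i /setIP[p'i ai] ->] | [/imsetP[i p'i ->] aj]].
    by rewrite imset_f // -above.
  by exists i; rewrite // inE p'i above.
by move=> i p'i; apply/matched_cohom/omB.
Qed.

End Criterion.

Theorem theorem2p10
  (sT : finGroupType) (S : {group sT}) (p : nat)
  (S_simple : simple S) (S_nonabelian : ~~ abelian S)
  (p_prime : prime p) (p_dvd_S : (p %| #|S|)%N)
  (gT : finGroupType) (G : {group gT}) (pi : {morphism G >-> sT})
  (G_cover : maximal_perfect_central_extension S pi)
  (Q : {group gT}) (Q_sylow : p.-Sylow(G) Q)
  (* (i): GD is the semidirect product of Gt and D *)
  (Gt D GD : {group gT})
  (G_normal_Gt : G <| Gt)
  (GD_sdprod : (Gt ><| D)%g = GD)
  (Gt_G_abelian : abelian (Gt / G))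
  (cent_G : 'C_GD(G)%g = 'Z(Gt)%g)
  (G_normal_GD : G <| GD)
  (GD_Aut : (conj_aut G @* GD)%g = Aut G)
  (* (ii) *)
  (N : {group gT})
  (N_stable : 'N_GD(Q)%g \subset 'N(N)%g)
  (norm_Q_N : 'N_G(Q)%g \subset N)
  (N_proper : N \proper G)
  (* (iii) *)
  (max_ext_G : maximal_extensibility G Gt)
  (max_ext_N : maximal_extensibility N 'N_Gt(N)%g)
  (* (iv) *)
  (Omega : Iirr Gt -> Iirr 'N_Gt(N)%g)
  (Omega_inj : {in Irr_over_p' p G Gt &, injective Omega})
  (Omega_img : Omega @: Irr_over_p' p G Gt = Irr_over_p' p N 'N_Gt(N)%g)
  (Omega_equiv : {in 'N_GD(Q)%g & Irr_over_p' p G Gt, forall a i,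
     Omega (conjg_Iirr i a) = conjg_Iirr (Omega i) a})
  (Omega_center : forall nu : Iirr 'Z(Gt)%g,
     Omega @: (Irr_over_p' p G Gt :&: Irr_above Gt nu) =
       Irr_over_p' p N 'N_Gt(N)%g :&: Irr_above 'N_Gt(N)%g nu)
  (Omega_mul : forall i (l : Iirr (Gt / G)%g), i \in Irr_over_p' p G Gt ->
     'chi_(Omega (cfIirr ('chi_i * ('chi_l %% G)%CF))) =
       'chi_(Omega i) * 'Res['N_Gt(N)%g] ('chi_l %% G)%CF)
  (* (v) *)
  (stab_G : {in Irr_over_p' p G Gt, forall i,
     exists i0 : Iirr G,
       [/\ i0 \in Irr_below G 'chi_i, i0 \in Irr_p' p G,
           ('I_Gt['chi_i0] ><| 'I_D['chi_i0])%g = 'I_GD['chi_i0]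
         & extends_to 'I_(G <*> D)['chi_i0] 'chi_i0]})
  (* (vi) *)
  (stab_N : {in Irr_over_p' p N 'N_Gt(N)%g, forall i,
     exists i0 : Iirr N,
       let O := ('I_('N_GD(N))['chi_i0] * G)%g in
       [/\ i0 \in Irr_below N 'chi_i,
           ((Gt :&: O) ><| (D :&: O))%g = O
         & extends_to 'I_('N_(G <*> D)(N))['chi_i0] 'chi_i0]}) :
  inductive_McKay p G Q.
Proof.
apply: (inductive_McKay_criterion (Q := Q) Q_sylow G_normal_Gt GD_sdprod
  Gt_G_abelian cent_G G_normal_GD N_stable norm_Q_N (proper_sub N_proper)
  max_ext_G max_ext_N Omega_inj Omega_img Omega_equiv Omega_center Omega_mul
  stab_G stab_N G_cover GD_Aut N_proper).
Qed.
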